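(* Let $V$ be a $2n$-dimensional vector space over a field $F$ and let $\Omega: V\times V\to F$ be a non-degenerate symplectic form. Let $n=2k\geq 14$ and let $f$ be a bijective transformation of ${\mathfrak H}_{k}(\Omega)$ preserving the class of base subsets. Then $f$ preserves the relation $\perp$ and induces a bijective transformation $\{U,U^{\perp}\}\mapsto\{f(U),f(U^\perp)\}$ of $\overline{{\mathfrak H}}_{k}(\Omega)$. Moreover, the latter mapping is induced by an element of $\Gamma{\rm Sp}(\Omega)$: there exists $l\in\Gamma{\rm Sp}(\Omega)$ such that $\{f(U),f(U^{\perp})\}=\{l(U),l(U^{\perp})\}$ for every $U\in{\mathfrak H}_{k}(\Omega)$.
   Context: Two subspaces $S,T\subset V$ are orthogonal, $S\perp T$, if $\Omega(x,y)=0$ for all $x\in S$, $y\in T$; $S^{\perp}$ is the orthogonal complement of $S$ with respect to $\Omega$. A subspace $S\subset V$ is non-degenerate if $\Omega|_{S}$ is non-degenerate. ${\mathfrak H}_{k}(\Omega)$ is the set of all $2k$-dimensional non-degenerate subspaces of $V$. For $n=2k$, $\overline{{\mathfrak H}}_{k}(\Omega)$ is the set of all subsets $\{U,U^{\perp}\}\subset{\mathfrak H}_{k}(\Omega)$. Base subsets. A symplectic base is a set $B=\{P_1,\dots,P_{2n}\}$ of $1$-dimensional subspaces of $V$ whose sum is $V$ such that for each $i$ there is a unique $\sigma(i)\in\{1,\dots,2n\}$ with $P_i\not\perp P_{\sigma(i)}$. The set ${\mathfrak S}_1=\{P_i+P_{\sigma(i)}: i=1,\dots,2n\}=\{S_1,\dots,S_n\}$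 (which consists of $n$ mutually orthogonal elements of ${\mathfrak H}_1(\Omega)$) is the base subset of ${\mathfrak H}_1(\Omega)$ associated with $B$. For $k\in\{2,\dots,n-1\}$ the base subset of ${\mathfrak H}_k(\Omega)$ defined by ${\mathfrak S}_1$ is the set of all sums $S_{i_1}+\dots+S_{i_k}$ with $i_1,\dots,i_k$ distinct. A bijection $f$ of ${\mathfrak H}_{k}(\Omega)$ to itself preserves the class of base subsets if both $f$ and $f^{-1}$ send base subsets of ${\mathfrak H}_{k}(\Omega)$ to base subsets of ${\mathfrak H}_{k}(\Omega)$. $\Gamma{\rm Sp}(\Omega)$ is the group of semi-linear automorphisms $l$ of $V$ preserving $\Omega$ in the following sense: there are an automorphism $\tau$ of $F$ (with respect to which $l$ is semi-linear) and a non-zero scalar $c\in F$ such that $\Omega(l(x),l(y))=c\,\tau(\Omega(x,y))$ for all $x,y\in V$. *)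

(* Defs.v *)
From mathcomp Require Import all_boot all_algebra.
From mathcomp Require Import sesquilinear.
From mathcomp Require Import classical_sets functions.

Set Implicit Arguments.
Unset Strict Implicit.
Unset Printing Implicit Defensive.

Import GRing.Theory.
Local Open Scope classical_set_scope.
Local Open Scope ring_scope.

Section SymplecticGrassmannian.
Variables (F : fieldType) (vT : vectType F) (om : {skew_symmetric vT}).
Implicit Types (S T U : {vspace vT}) (A : set {vspace vT}).

(* By orthovP this is equivalent to om x y = 0 for all x in S and y in T. *)
Definition perpv S T : bool := (S <= orthov om T)%VS.

Definition nondegenerate_on S : Prop :=
  forall x, x \in S -> (forall y, y \in S -> om x y = 0) -> x = 0.

Definition Hgrass (k : nat) : set {vspace vT} :=
  [set U | \dim U = (2 * k)%N /\ nondegenerate_on U].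

Definition Hgrass_bar (k : nat) : set (set {vspace vT}) :=
  [set A | exists2 U, A = [set U; orthov om U] & A `<=` Hgrass k].

(* The lines are indexed by the dimension of vT, so the second condition forces
   them to be pairwise distinct. *)
Definition symplectic_base (P : 'I_(\dim {:vT}) -> {vspace vT}) : Prop :=
  [/\ forall i, \dim (P i) = 1%N,
      (\sum_i P i)%VS = fullv
    & forall i, exists! j, ~~ perpv (P i) (P j)].

(* For a symplectic base, the j below is the index sigma(i) attached to i. *)
Definition base_planes (P : 'I_(\dim {:vT}) -> {vspace vT}) :
    set {vspace vT} :=
  [set S | exists i j, ~~ perpv (P i) (P j) /\ S = (P i + P j)%VS].

Definition base_subset (k : nat) A : Prop :=
  exists2 P, symplectic_base P &
    A = [set U | exists s : seq {vspace vT},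
          [/\ size s = k, uniq s, [set` s] `<=` base_planes P
            & U = (\sum_(S <- s) S)%VS]].

(* Only the values of f on Hgrass k matter: the second clause is about the
   inverse of f as a self-bijection of Hgrass k. *)
Definition preserves_base_subsets (k : nat) (f : {vspace vT} -> {vspace vT}) :=
  (forall A, base_subset k A -> base_subset k (f @` A)) /\
  (forall A, base_subset k A -> base_subset k (Hgrass k `&` f @^-1` A)).

Definition GammaSp : set (vT -> vT) :=
  [set l | exists tau : {rmorphism F -> F},
     [/\ bijective tau, GRing.linear_for (tau \; *:%R) l, bijective l
       & exists2 c : F, c != 0 &
           forall x y, om (l x) (l y) = c * tau (om x y)]].

End SymplecticGrassmannian.

(* Main.v *)
Require Import Defs.
From HB Require Import structures.
From mathcomp Require Import all_boot all_algebra fingroup perm.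
From mathcomp Require Import sesquilinear.
From mathcomp Require Import zify.
From mathcomp Require Import boolp classical_sets functions.

(* A base subset is the family of all sums of k planes taken from a frame, that
   is, from n mutually orthogonal non-degenerate planes.  A subset of a base
   subset lies in no other base subset exactly when it separates every two
   planes i, j of the frame; as f preserves this property, it carries the pairs
   {i, j} to pairs, compatibly with separation, and these pairs of a frame have
   the structure of a complete graph.  Hence, on each frame, f is induced by a
   bijection onto another frame, up to taking orthogonal complements.  The image
   of a plane does not depend on the frame, since any two frames through the
   plane are joined by a chain of frames with large overlaps.  The resulting
   bijection of the non-degenerate planes preserves orthogonality, therefore
   the relation of meeting in a line, therefore it comes from a bijection of the
   points preserving orthogonality.  A line being the double orthogonal of two
   of its points, this is a collineation, and the fundamental theorem of
   projective geometry makes it semilinear. *)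

Set Implicit Arguments.
Unset Strict Implicit.
Unset Printing Implicit Defensive.

Import GRing.Theory.
Local Open Scope ring_scope.

(** * Symplectic linear algebra *)

(** For n = 2k every base subset contains [perp U] along with U, so a map that swaps the two members
    of some pairs, chosen at will, preserves base subsets. Hence f can only be described up to
    complements, with a choice that varies from one member to the next. Two facts absorb this
    ambiguity: I and its complement separate the same pairs of indices, and the symmetric difference
    of two members changes at most into its complement, which has another dimension when it consists
    of two planes. Pairs go to pairs by counting: the families of k-sets that do not separate a
    given pair all have the same size, so as soon as the image of one such family lies in another,
    it fills it. The bound n >= 14, that is k >= 7, provides room in three places: the parity
    argument handles six indices at a time and needs a seventh one; the chain of frames needs a
    plane orthogonal to up to k planes of a frame and to two further planes; and the passage to
    points needs the orthogonal complement of a sum of two planes to be larger than that sum. *)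

Section Symplectic.
Variables (F : fieldType) (vT : vectType F) (om : {skew_symmetric vT}).
Hypothesis sympl : is_psymplectic om.
Implicit Types (S T U W Z : {vspace vT}) (x y z : vT).

Local Notation nd := (nondegenerate_on om).
Local Notation perp := (orthov om).
Local Notation plane := (Hgrass om 1).

Lemma omDl x y z : om (x + y) z = om x z + om y z.
Proof. exact: linearDl. Qed.

Lemma omDr x y z : om x (y + z) = om x y + om x z.
Proof. exact: linearDr. Qed.

Lemma omZl a x y : om (a *: x) y = a * om x y.
Proof. exact: linearZl_LR. Qed.

Lemma omZr a x y : om x (a *: y) = a * om x y.
Proof. exact: linearZr_LR. Qed.

Lemma omC x y : om x y = - om y x.
Proof. by rewrite hermC expr1 mulN1r. Qed.

Lemma om_eq0C x y : (om x y == 0) = (om y x == 0).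
Proof. by rewrite omC oppr_eq0. Qed.

(** The hypothesis gives alternation only in characteristic 2; elsewhere skew-symmetry yields 2
    [om x x] = 0. *)
Lemma om_alt x : om x x = 0.
Proof.
have [_ _ om2] := sympl.
have [|n2] := boolP (2%N \in [pchar F]); first by move=> /om2.
have: om x x *+ 2 = 0 by rewrite mulr2n {1}omC addNr.
move/eqP; rewrite -mulr_natr mulf_eq0 => /orP[/eqP //|/eqP e].
by move: n2; rewrite inE /= e eqxx.
Qed.

Lemma om_nondeg x : (forall y, om x y = 0) -> x = 0.
Proof.
have [/eqP nd _ _] := sympl => h; apply/eqP; rewrite -memv0 -nd.
by apply/mem_orthovP => y _.
Qed.

Lemma mem_perp U x : reflect (forall y, y \in U -> om x y = 0) (x \in perp U).
Proof. exact: mem_orthovP. Qed.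

Lemma perpvC S T : perpv om S T = perpv om T S.
Proof. exact: orthov_sym. Qed.

Lemma perpvP S T :
  reflect (forall x y, x \in S -> y \in T -> om x y = 0) (perpv om S T).
Proof. by apply: (iffP orthovP) => h x y *; apply: h. Qed.

Lemma perpS U W : (U <= W)%VS -> (perp W <= perp U)%VS.
Proof.
move=> /subvP UW; apply/subvP => x /mem_perp h.
by apply/mem_perp => y /UW; apply: h.
Qed.

Lemma sub_perpK U : (U <= perp (perp U))%VS.
Proof. by rewrite orthov_sym. Qed.

(** Each vector of a basis of W cuts the dimension by at most one. *)
Lemma dim_cap_perp_ge U W : (\dim U <= \dim (U :&: perp W) + \dim W)%N.
Proof.
suff H (X : seq vT) : (\dim U <= \dim (U :&: perp <<X>>) + size X)%N.
  by have := H (vbasis W); rewrite (span_basis (vbasisP W)) size_tuple.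
elim: X => [|x X IH] /=; first by rewrite span_nil orthov0 capvf addn0.
apply: leq_trans IH _; rewrite addnS -addSn leq_add2r.
rewrite span_cons.
have: (U :&: perp <<X>> :&: perp <[x]> <= U :&: perp (<[x]> + <<X>>))%VS.
  apply/subvP => z /memv_capP[/memv_capP[zU /mem_perp zX] /mem_perp zx].
  rewrite memv_cap zU; apply/mem_perp => y /memv_addP[a ax [b bX ->]].
  by rewrite omDr zx // zX // addr0.
move/dimvS; have := leq_dim_orthov1 om x (U :&: perp <<X>>).
by case: (\dim (U :&: perp <<X>>)) => // d /= h1 h2;
  rewrite ltnS (leq_trans h1).
Qed.

(** One inequality is the previous lemma. If the sum were too large, a complement C of [perp U]
    would be smaller than U, so some non-zero vector of U would be orthogonal to C; being orthogonal
    to [perp U] as well, it would lie in the radical. *)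
Lemma dim_perp U : (\dim U + \dim (perp U))%N = \dim {:vT}.
Proof.
apply/eqP; rewrite eqn_leq; apply/andP; split; last first.
  by have := dim_cap_perp_ge fullv U; rewrite capfv addnC.
rewrite leqNgt; apply/negP => lt.
set C := ((perp U)^C)%VS.
have dC : (\dim C < \dim U)%N.
  by rewrite dimv_compl ltn_subLR ?(dimvS (subvf _)) // addnC.
have : (U :&: perp C)%VS = 0%VS.
  apply/eqP; rewrite -subv0; apply/subvP => x /memv_capP[xU /mem_perp xC].
  rewrite memv0; apply/eqP/om_nondeg => y.
  have : y \in (perp U + C)%VS by rewrite addv_complf memvf.
  move=> /memv_addP[a /mem_perp aU [b bC ->]]; rewrite omDr (xC b bC) addr0.
  by apply/eqP; rewrite om_eq0C aU.
have := dim_cap_perp_ge U C => /[swap] ->; rewrite dimv0 add0n leqNgt.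
by rewrite dC.
Qed.

Lemma perpK U : perp (perp U) = U.
Proof.
apply/esym/eqP; rewrite eqEdim sub_perpK /=.
by rewrite -(leq_add2r (\dim (perp U))) addnC !dim_perp.
Qed.

Lemma perpD U W : perp (U + W) = (perp U :&: perp W)%VS.
Proof.
apply/eqP; rewrite eqEsubv subv_cap !perpS ?addvSl ?addvSr //=.
by rewrite orthov_sym subv_add !(orthov_sym _ _ (perp U :&: perp W)) capvSl
  capvSr.
Qed.

Lemma perpI U W : perp (U :&: W) = (perp U + perp W)%VS.
Proof. by rewrite -[RHS]perpK perpD !perpK. Qed.

Lemma nd_cap U : nd U -> (U :&: perp U = 0)%VS.
Proof.
move=> ndU; apply/eqP; rewrite -subv0; apply/subvP => x.
by move=> /memv_capP[xU /mem_perp h]; rewrite memv0; apply/eqP/ndU.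
Qed.

Lemma nd_add_perp U : nd U -> (U + perp U = fullv)%VS.
Proof.
move=> ndU; apply/eqP; rewrite eqEdim subvf /=.
by rewrite dimv_disjoint_sum ?nd_cap // dim_perp.
Qed.

Lemma nd_perp U : nd U -> nd (perp U).
Proof.
move=> ndU x /mem_perp xU xh; apply: om_nondeg => y.
have : y \in (U + perp U)%VS by rewrite nd_add_perp // memvf.
by move=> /memv_addP[a aU [b bU ->]]; rewrite omDr xU // xh // addr0.
Qed.

Lemma Hgrass_perp k n U : \dim {:vT} = (2 * n)%N -> Hgrass om k U ->
  Hgrass om (n - k) (perp U).
Proof.
move=> dV [dU ndU]; split; last exact: nd_perp.
by apply/eqP; rewrite -(eqn_add2l (\dim U)) dim_perp dU dV -mulnDr subnKC //
  -(leq_pmul2l (m := 2)) // -dU -dV dimvS ?subvf.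
Qed.

Lemma nd_cap_perp U W : nd U -> (W <= perp U)%VS -> (U :&: W = 0)%VS.
Proof.
move=> ndU WU; apply/eqP; rewrite -subv0 -(nd_cap ndU).
by apply: capvS (subvv _) WU.
Qed.

Lemma nd_add U W : nd U -> nd W -> (W <= perp U)%VS -> nd (U + W)%VS.
Proof.
move=> ndU ndW WU x /memv_addP[a aU [b bW ->]] h.
have /orthovP WU' := WU.
have a0 : a = 0.
  apply: ndU => // y yU; have := h y (subvP (addvSl _ _) _ yU).
  by rewrite omDl (WU' b y) // addr0.
move: h; rewrite a0 add0r => h; apply: ndW => // y yW.
exact: h y (subvP (addvSr _ _) _ yW).
Qed.

Lemma Hgrass_add a b U W : Hgrass om a U -> Hgrass om b W -> (W <= perp U)%VS ->
  Hgrass om (a + b) (U + W)%VS.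
Proof.
move=> [dU ndU] [dW ndW] WU; split; last exact: nd_add.
by rewrite dimv_disjoint_sum ?nd_cap_perp // dU dW mulnDr.
Qed.

Lemma mem_lineD x y z :
  reflect (exists a b, z = a *: x + b *: y) (z \in <[x]> + <[y]>)%VS.
Proof.
apply: (iffP memv_addP) => [[_ /vlineP[a ->] [_ /vlineP[b ->] ->]]|[a [b ->]]].
  by exists a, b.
by exists (a *: x); rewrite ?memvZ ?memv_line //; exists (b *: y);
  rewrite ?memvZ ?memv_line.
Qed.

Lemma memv_line2l x y : x \in (<[x]> + <[y]>)%VS.
Proof. exact: subvP (addvSl _ _) _ (memv_line x). Qed.

Lemma memv_line2r x y : y \in (<[x]> + <[y]>)%VS.
Proof. exact: subvP (addvSr _ _) _ (memv_line y). Qed.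

Lemma line2_sub x y U : (<[x]> + <[y]> <= U)%VS = (x \in U) && (y \in U).
Proof. by rewrite subv_add !memvE. Qed.

Lemma dim1_line U : \dim U = 1%N -> exists x, U = <[x]>%VS.
Proof.
move=> dU; exists (vpick U); apply/esym/eqP.
by rewrite eqEdim -memvE memv_pick dim_vline vpick0 -dimv_eq0 dU.
Qed.

Lemma plane_line2 x y : om x y != 0 -> plane (<[x]> + <[y]>)%VS.
Proof.
move=> xy; split.
  have x0 : x != 0 by apply: contraNneq xy => ->; rewrite linear0l.
  have y0 : y != 0 by apply: contraNneq xy => ->; rewrite linear0r.
  rewrite dimv_disjoint_sum ?dim_vline ?x0 ?y0 //.
  apply/eqP; rewrite -subv0; apply/subvP => _ /memv_capP[/vlineP[a ->]].
  move=> /vlineP[b e]; rewrite memv0; have : om (a *: x) y = 0.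
    by rewrite e omZl om_alt mulr0.
  rewrite omZl => /eqP; rewrite mulf_eq0 (negPf xy) orbF => /eqP ->.
  by rewrite scale0r.
move=> _ /mem_lineD[a [b ->]] h.
have := h y (memv_line2r _ _); have := h x (memv_line2l _ _).
rewrite !omDl !omZl !om_alt !mulr0 addr0 add0r.
move=> /eqP; rewrite mulf_eq0 om_eq0C (negPf xy) orbF => /eqP ->.
move=> /eqP; rewrite mulf_eq0 (negPf xy) orbF => /eqP ->.
by rewrite !scale0r addr0.
Qed.

Lemma plane_eq S x y : plane S -> x \in S -> y \in S -> om x y != 0 ->
  S = (<[x]> + <[y]>)%VS.
Proof.
move=> [dS _] xS yS /plane_line2[d _].
by apply/esym/eqP; rewrite eqEdim line2_sub xS yS d dS.
Qed.

Lemma plane_exists2 S x : plane S -> x \in S -> x != 0 ->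
  exists2 y, y \in S & om x y != 0.
Proof.
move=> [_ ndS] xS x0; apply: contrapT => h; case/eqP: x0; apply: ndS => // y yS.
by apply: contrapT => /eqP xy; apply: h; exists y.
Qed.

Lemma planeP S : plane S -> exists x y, om x y = 1 /\ S = (<[x]> + <[y]>)%VS.
Proof.
move=> pS; have /subvPn[x xS] : ~~ (S <= 0)%VS.
  by rewrite subv0 -dimv_eq0; case: pS => ->.
rewrite memv0 => x0; have [y yS xy] := plane_exists2 pS xS x0.
exists x, ((om x y)^-1 *: y); rewrite omZr mulVf //; split=> //.
by apply: plane_eq; rewrite ?memvZ ?omZr ?mulVf ?oner_neq0.
Qed.

Lemma plane_mem_line S x y : plane S -> x \in S -> y \in S -> x != 0 ->
  om x y = 0 -> y \in <[x]>%VS.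
Proof.
move=> pS xS yS x0 xy; have [z zS xz] := plane_exists2 pS xS x0.
move: yS; rewrite (plane_eq pS xS zS xz) => /mem_lineD[a [b yE]].
move: xy; rewrite yE omDr !omZr om_alt mulr0 add0r => /eqP.
rewrite mulf_eq0 (negPf xz) orbF => /eqP ->.
by rewrite scale0r addr0 memvZ // memv_line.
Qed.

Lemma sub_plane Z : ~~ (Z <= perp Z)%VS -> exists2 S, plane S & (S <= Z)%VS.
Proof.
move=> /subvPn[x xZ /mem_orthovPn[y yZ xy]].
by exists (<[x]> + <[y]>)%VS; rewrite ?line2_sub ?xZ //; apply: plane_line2.
Qed.

Lemma om_exists x : x != 0 -> exists y, om x y != 0.
Proof.
move=> x0; apply: contrapT => h; case/eqP: x0; apply: om_nondeg => y.
by apply: contrapT => /eqP xy; apply: h; exists y.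
Qed.

Lemma om_exists2 x y : x != 0 -> y != 0 -> exists z, om x z != 0 /\ om y z != 0.
Proof.
move=> /om_exists[z xz] /om_exists[w yw].
have [yz|yz] := eqVneq (om y z) 0; last by exists z.
have [xw|xw] := eqVneq (om x w) 0; last by exists w.
by exists (z + w); rewrite !omDr xw yz addr0 add0r.
Qed.

End Symplectic.

(** * Frames of mutually orthogonal planes *)

Section Frames.
Variables (F : fieldType) (vT : vectType F) (om : {skew_symmetric vT}).
Hypothesis sympl : is_psymplectic om.
Variable n : nat.
Implicit Types (Fr G : 'I_n -> {vspace vT}) (I J K : {set 'I_n}).
Implicit Types (S T U W : {vspace vT}).

Local Notation perp := (orthov om).
Local Notation plane := (Hgrass om 1).

(** A frame under construction: the values of [Fr] off K are arbitrary, which keeps the type fixed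
    while planes are added one at a time. *)
Definition pframe K Fr :=
  (forall i, i \in K -> plane (Fr i)) /\
  (forall i j, i \in K -> j \in K -> i != j -> perpv om (Fr i) (Fr j)).

Definition frame Fr :=
  (forall i, plane (Fr i)) /\ (forall i j, i != j -> perpv om (Fr i) (Fr j)).

Definition fsum Fr I : {vspace vT} := (\sum_(i in I) Fr i)%VS.

Lemma frame_pframe K Fr : frame Fr -> pframe K Fr.
Proof. by move=> [h1 h2]; split=> *; [apply: h1 | apply: h2]. Qed.

Lemma pframeT Fr : pframe [set: 'I_n] Fr -> frame Fr.
Proof. by move=> [h1 h2]; split=> *; [apply: h1 | apply: h2]; rewrite ?inE. Qed.

Lemma fsum_sup Fr I i : i \in I -> (Fr i <= fsum Fr I)%VS.
Proof. by move=> iI; apply: (sumv_sup i). Qed.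

Lemma fsum_subP Fr I U :
  reflect (forall i, i \in I -> (Fr i <= U)%VS) (fsum Fr I <= U)%VS.
Proof. exact: subv_sumP. Qed.

Lemma fsumS Fr I J : I \subset J -> (fsum Fr I <= fsum Fr J)%VS.
Proof.
by move=> /fintype.subsetP IJ; apply/fsum_subP => i /IJ; apply: fsum_sup.
Qed.

Lemma fsum1 Fr i : fsum Fr [set i] = Fr i.
Proof. exact: big_set1. Qed.

Lemma fsum0 Fr : fsum Fr finset.set0 = 0%VS.
Proof. exact: big_set0. Qed.

Lemma fsumU Fr I J : fsum Fr (I :|: J) = (fsum Fr I + fsum Fr J)%VS.
Proof.
apply/eqP; rewrite eqEsubv subv_add !fsumS ?finset.subsetUl ?finset.subsetUr
  //=.
rewrite andbT.
apply/fsum_subP => i; rewrite inE => /orP[] /(fsum_sup Fr) h;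
  apply: subv_trans h _.
  exact: addvSl.
exact: addvSr.
Qed.

Lemma eq_fsum Fr G I : (forall i, i \in I -> Fr i = G i) ->
  fsum Fr I = fsum G I.
Proof. by move=> h; apply: eq_bigr. Qed.

Lemma fsum_perpv K Fr I J : pframe K Fr -> I \subset K -> J \subset K ->
  [disjoint I & J] -> (fsum Fr I <= perp (fsum Fr J))%VS.
Proof.
move=> [_ p] /fintype.subsetP IK /fintype.subsetP JK d.
apply/fsum_subP => i iI; rewrite orthov_sym; apply/fsum_subP => j jJ.
apply: p (JK j jJ) (IK i iI) _; apply: contraTneq jJ => ->.
by rewrite (disjointFr d).
Qed.

Lemma fsum_Hgrass K Fr I : pframe K Fr -> I \subset K ->
  Hgrass om #|I| (fsum Fr I).
Proof.
move=> pF; have [m] := ubnP #|I|; elim: m I => // m IH I.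
have [->|/finset.set0Pn[i iI]] := eqVneq I finset.set0.
  rewrite fsum0 finset.cards0 => _ _; split; first by rewrite dimv0.
  by move=> x; rewrite memv0 => /eqP.
rewrite (finset.cardsD1 i) iI ltnS => lt sIK.
have sub : I :\ i \subset K by apply: fintype.subset_trans sIK;
  apply: finset.subsetDl.
have -> : I = i |: (I :\ i) by rewrite finset.setD1K.
have iK : i \in K by apply: (fintype.subsetP sIK).
rewrite fsumU fsum1 finset.setU1K ?finset.setD11 // ; apply: Hgrass_add.
- exact: (proj1 pF).
- exact: IH.
rewrite -[Fr i]fsum1; apply: (fsum_perpv pF) => //.
  by rewrite finset.sub1set.
by rewrite disjoint_sym finset.disjoints1 finset.setD11.
Qed.

Lemma frame_Hgrass Fr I : frame Fr -> Hgrass om #|I| (fsum Fr I).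
Proof. by move=> /(frame_pframe I) /fsum_Hgrass; apply. Qed.

Lemma dim_fsum Fr I : frame Fr -> \dim (fsum Fr I) = (2 * #|I|)%N.
Proof. by case/(@frame_Hgrass Fr I). Qed.

Hypothesis dimV : \dim {:vT} = (2 * n)%N.

Lemma fsumT Fr : frame Fr -> fsum Fr [set: 'I_n] = fullv.
Proof.
by move=> fF; apply/eqP; rewrite eqEdim subvf dim_fsum //
  dimV finset.cardsT card_ord leqnn.
Qed.

Lemma perp_fsum Fr I : frame Fr -> perp (fsum Fr I) = fsum Fr (~: I).
Proof.
move=> fF; apply/esym/eqP; rewrite eqEdim; apply/andP; split.
  apply: (fsum_perpv (frame_pframe finset.setT fF)); rewrite ?finset.subsetT //.
  by rewrite disjoint_sym finset.disjoints_subset finset.setCK.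
rewrite -(leq_add2l (\dim (fsum Fr I))) dim_perp // dimV !dim_fsum //.
by rewrite -mulnDr finset.cardsC card_ord.
Qed.

Lemma fsumI Fr I J : frame Fr -> fsum Fr (I :&: J) = (fsum Fr I :&: fsum Fr
  J)%VS.
Proof.
move=> fF; rewrite -[RHS](perpK sympl) (perpI sympl) !perp_fsum // -fsumU.
by rewrite perp_fsum // finset.setCU !finset.setCK.
Qed.

Lemma fsum_sub Fr I J : frame Fr -> (fsum Fr I <= fsum Fr J)%VS = (I \subset J).
Proof.
move=> fF; apply/idP/idP => [/capv_idPl|/fsumS//].
rewrite -fsumI // => e; apply/finset.setIidPl/eqP.
rewrite eqEcard finset.subsetIl /= -(leq_pmul2l (m := 2)) //.
by rewrite -!(dim_fsum _ fF) e.
Qed.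

Lemma fsum_inj Fr : frame Fr -> injective (fsum Fr).
Proof.
move=> fF I J e; apply/eqP; rewrite finset.eqEsubset -!(fsum_sub _ _ fF) e.
by rewrite subvv.
Qed.

Lemma pframe_add K Fr i S : pframe K Fr -> i \notin K -> plane S ->
  (S <= perp (fsum Fr K))%VS -> pframe (i |: K) (fun j =>
    if j == i then S else Fr j).
Proof.
move=> [h1 h2] iK pS SK; pose G j := if j == i then S else Fr j.
have Gi : G i = S by rewrite /G eqxx.
have GK j : j \in K -> G j = Fr j.
  by move=> jK; rewrite /G; case: eqP => // e; rewrite -e jK in iK.
have SF j : j \in K -> (S <= perp (Fr j))%VS.
  by move=> jK; apply: subv_trans SK _; apply: perpS; apply: fsum_sup.
rewrite -/G; split=> [j|j l]; rewrite !inE.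
  by move=> /predU1P[->|jK]; rewrite ?Gi // GK //; apply: h1.
move=> /predU1P[->|jK] /predU1P[->|lK]; rewrite ?eqxx // ?Gi ?GK //.
- by move=> _; apply: SF.
- by move=> _; rewrite perpvC; apply: SF.
- exact: h2.
Qed.

Lemma notin_dim K Fr U : pframe K Fr -> (\dim (fsum Fr K) < \dim U)%N ->
  exists i, i \notin K.
Proof.
move=> pF; have [-> _] := fsum_Hgrass pF (fintype.subxx K).
move=> lt; have /fintype.subsetPn[i _ iK] : ~~ (finset.setT \subset K);
  last by exists i.
apply/negP => /subset_leq_card; rewrite finset.cardsT card_ord => le.
have := leq_trans lt (dimvS (subvf U)).
by rewrite dimV ltn_pmul2l // ltnNge le.
Qed.

Lemma nd_cap_perp_sub U W : nondegenerate_on om U -> nondegenerate_on om W ->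
  (W <= U)%VS -> nondegenerate_on om (U :&: perp W) /\ (W + (U :&: perp W))%VS =
    U.
Proof.
move=> ndU ndW WU; have e : (W + (U :&: perp W))%VS = U.
  by rewrite capvC vspace_modl // nd_add_perp // capfv.
split=> // x /memv_capP[xU /mem_perp xW] h; apply: ndU => // y.
by rewrite -{1}e => /memv_addP[a aW [b bZ ->]]; rewrite omDr xW // h // addr0.
Qed.

(** As long as the sum is not U, its orthogonal complement inside U is non-degenerate and non-zero,
    so it contains a plane, which is placed at an index outside K. *)
Lemma pframe_extend U K Fr : nondegenerate_on om U -> pframe K Fr ->
  (fsum Fr K <= U)%VS -> exists J G,
    [/\ pframe J G, K \subset J, {in K, forall i, G i = Fr i} & fsum G J = U].
Proof.
move=> ndU; have [m] := ubnP #|~: K|; elim: m K Fr => // m IH K Fr lt pF FU.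
have [e|ne] := eqVneq (fsum Fr K) U; first by exists K, Fr.
have [dK ndK] := fsum_Hgrass pF (fintype.subxx K).
have [ndZ eZ] := nd_cap_perp_sub ndU ndK FU.
have [S pS] : exists2 S, plane S & (S <= U :&: perp (fsum Fr K))%VS.
  apply: sub_plane sympl _ _; apply/negP => /capv_idPl; rewrite nd_cap // => Z0.
  by move: ne; rewrite -eZ -Z0 addv0 eqxx.
rewrite subv_cap => /andP[SU SZ].
have [|i iK] := @notin_dim K Fr U pF.
  by rewrite ltnNge; apply: contraNN ne => le; rewrite eqEdim FU.
pose G j := if j == i then S else Fr j.
have GK : {in K, forall j, G j = Fr j}.
  by move=> j jK; rewrite /G; case: eqP => // e; rewrite -e jK in iK.
have [|||J [H [pH sKJ eH fU]]] := IH (i |: K) G.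
- rewrite -ltnS; apply: leq_trans lt; rewrite ltnS; apply: proper_card.
  rewrite finset.properEneq finset.setCS finset.subsetU1 andbT.
  by apply: contraNneq iK => /finset.setC_inj <-; rewrite !inE eqxx.
- exact: pframe_add.
- rewrite fsumU fsum1 subv_add {1}/G eqxx SU /=.
  by rewrite (eq_fsum (G := Fr)).
exists J, H; split=> //; first exact: fintype.subset_trans (finset.subsetU1 _ _)
  sKJ.
by move=> j jK; rewrite eH ?GK // !inE jK orbT.
Qed.

Lemma frame_extend K Fr : pframe K Fr ->
  exists2 G, frame G & {in K, forall i, G i = Fr i}.
Proof.
move=> pF; have [||J [G [pG KJ eG GT]]] := @pframe_extend fullv K Fr _ pF.
- by move=> x _ h; apply: (om_nondeg sympl) => y; apply: h; apply: memvf.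
- exact: subvf.
exists G => //; suff JT : J = finset.setT by apply: pframeT; rewrite -JT.
have [dJ _] := fsum_Hgrass pG (fintype.subxx J).
apply/eqP; rewrite eqEcard finset.subsetT finset.cardsT card_ord.
by rewrite -(leq_pmul2l (m := 2)) // -dJ GT dimV leqnn.
Qed.

Lemma Hgrass_frame k U : Hgrass om k U ->
  exists Fr I, [/\ frame Fr, #|I| = k & U = fsum Fr I].
Proof.
move=> [dU ndU]; pose Fr0 (_ : 'I_n) : {vspace vT} := 0%VS.
have [||J [G [pG _ _ GU]]] := @pframe_extend U finset.set0 Fr0 ndU.
- by split=> i; rewrite ?inE // => j; rewrite inE.
- by rewrite fsum0 sub0v.
have [H fH eH] := frame_extend pG; exists H, J; split=> //.
  have [dJ _] := fsum_Hgrass pG (fintype.subxx J).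
  by apply/eqP; rewrite -(eqn_pmul2l (m := 2)) // -dJ GU dU.
by rewrite -GU; apply: eq_fsum => i iJ; rewrite eH.
Qed.

(** Only the planes indexed by K are kept; those outside K and i may all change. *)
Lemma frame_replace Fr K i S : frame Fr -> i \notin K -> plane S ->
  (S <= perp (fsum Fr K))%VS ->
  exists G, [/\ frame G, {in K, forall j, G j = Fr j} & G i = S].
Proof.
move=> fF iK pS SK.
have [G fG eG] := frame_extend (pframe_add (frame_pframe K fF) iK pS SK).
exists G; split=> // [j jK|]; last by rewrite eG ?inE ?eqxx.
by rewrite eG ?inE ?jK ?orbT //; case: eqP iK => // <-; rewrite jK.
Qed.

End Frames.

(** * Base subsets as families of k-subsets of a frame *)

Section BaseSubsets.
Variables (F : fieldType) (vT : vectType F) (om : {skew_symmetric vT}).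
Hypothesis sympl : is_psymplectic om.
Variable n : nat.
Hypothesis dimV : \dim {:vT} = (2 * n)%N.
Implicit Types (Fr G : 'I_n -> {vspace vT}) (I J K : {set 'I_n}).

Definition fam k Fr : set {vspace vT} :=
  [set U | exists2 I : {set 'I_n}, #|I| = k & U = fsum Fr I]%classic.

Lemma frame_inj Fr : frame om Fr -> injective Fr.
Proof.
move=> fF i j e; apply: finset.set1_inj; apply: (fsum_inj sympl dimV fF).
by rewrite !fsum1.
Qed.

Lemma fam_base_planes k Fr P : frame om Fr ->
  base_planes om P = range Fr ->
  [set U | exists s : seq {vspace vT},
     [/\ size s = k, uniq s, ([set` s] `<=` base_planes om P)%classic
       & U = (\sum_(S <- s) S)%VS]]%classic = fam k Fr.
Proof.
move=> fF ->; apply/seteqP; split=> U /=.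
  move=> [s [ss us sP ->]].
  pose I := [set i : 'I_n | Fr i \in s]%SET.
  have pI : perm_eq s [seq Fr i | i <- enum I].
    apply: uniq_perm => //; first by rewrite map_inj_uniq ?enum_uniq //;
      apply: frame_inj.
    move=> S; apply/idP/mapP => [Ss|[i]]; last by rewrite mem_enum inE => + ->.
    have [i _ iS] := sP _ Ss; exists i => //.
    by rewrite mem_enum inE iS.
  exists I; first by rewrite cardE -ss (perm_size pI) size_map.
  by rewrite (perm_big _ pI) /= big_map big_enum.
move=> [I cI ->]; exists [seq Fr i | i <- enum I]; split.
- by rewrite size_map -cardE.
- by rewrite map_inj_uniq ?enum_uniq //; apply: frame_inj.
- by move=> S /= /mapP[i _ ->]; exists i.
- by rewrite big_map big_enum.
Qed.

(** A hyperbolic pair in each plane gives 2n lines indexed by ['I_n * bool], where the partner of a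
    line is found by flipping the boolean; [c] and [d] transport this to the indices required by
    [symplectic_base]. *)
Lemma fam_base k Fr : frame om Fr -> base_subset om k (fam k Fr).
Proof.
move=> fF; have [pF oF] := fF.
have /choice[ab abP] i : exists ab : vT * vT,
    om ab.1 ab.2 = 1 /\ Fr i = (<[ab.1]> + <[ab.2]>)%VS.
  by have [a [b []]] := planeP sympl (pF i); exists (a, b).
pose v (p : 'I_n * bool) := if p.2 then (ab p.1).1 else (ab p.1).2.
have vF p : v p \in Fr p.1.
  have [_ ->] := abP p.1; rewrite /v; case: p.2;
    [exact: memv_line2l|exact: memv_line2r].
have om_v p q : (om (v p) (v q) != 0) = (q == (p.1, ~~ p.2)).
  case: p q => i b [j c] /=; rewrite -pair_eqE /=.
  have [->|ji] := eqVneq j i; last first.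
    by rewrite (perpvP _ _ _ (oF i j _) _ _ (vF (i, b)) (vF (j, c))) ?eqxx //
      eq_sym.
  have [e _] := abP i; case: b c => -[]; rewrite /v /= ?om_alt ?eqxx //.
    by rewrite e oner_neq0.
  by rewrite (om_eq0C om) e oner_neq0.
have cd : \dim {:vT} = #|{: 'I_n * bool}|.
  by rewrite dimV card_prod card_ord card_bool mulnC.
pose c m : 'I_n * bool := enum_val (cast_ord cd m).
pose d p := cast_ord (esym cd) (enum_rank p).
have dK p : c (d p) = p by rewrite /c /d cast_ordKV enum_rankK.
have cK m : d (c m) = m by rewrite /c /d enum_valK cast_ordK.
pose P m := <[v (c m)]>%VS.
have perpP i j : ~~ perpv om (P i) (P j) = (c j == ((c i).1, ~~ (c i).2)).
  by rewrite /perpv orthov11 om_v.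
have bP : base_planes om P = range Fr.
  apply/seteqP; split=> S /=.
    move=> [i [j [h ->]]]; exists (c i).1 => //.
    move: (h); rewrite perpP => /eqP e.
    have vj : v (c j) \in Fr (c i).1 by have := vF (c j); rewrite e.
    by apply: (plane_eq sympl (pF _) (vF _) vj); rewrite om_v e.
  move=> [i _ <-]; exists (d (i, true)), (d (i, false)).
  rewrite perpP !dK; split; first exact: eqxx.
  by rewrite /P !dK; have [_ ->] := abP i.
exists P; last by rewrite (fam_base_planes _ fF bP).
split.
- move=> m; rewrite dim_vline; suff -> : v (c m) != 0 by [].
  have := om_v (c m) ((c m).1, ~~ (c m).2); rewrite eqxx.
  by apply: contraTneq => ->; rewrite linear0l eqxx.
- apply/eqP; rewrite eqEsubv subvf /=.
  apply: (@subv_trans _ _ (fsum Fr [set: 'I_n]));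
    first by rewrite (fsumT dimV fF).
  apply/fsum_subP => i _.
  have [_ ->] := abP i; rewrite subv_add; apply/andP; split.
    by apply: (sumv_sup (d (i, true))) => //; rewrite /P dK.
  by apply: (sumv_sup (d (i, false))) => //; rewrite /P dK.
- move=> m; exists (d ((c m).1, ~~ (c m).2)); split;
    first by rewrite perpP dK eqxx.
  by move=> j; rewrite perpP => /eqP <-; rewrite cK.
Qed.

(** Lines are isotropic, so the partner map s is an involution without fixed points. The indices
    with i < s i pick one line from each pair; s carries them onto the remaining ones, so there are
    n of them. *)
Lemma base_fam k A : base_subset om k A -> exists2 Fr,
  frame om Fr & A = fam k Fr.
Proof.
move=> [P [P1 _ Pu] ->].
have /choice[s sP] i : exists j, unique (fun j =>
  ~~ perpv om (P i) (P j)) j by exact: Pu.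
have s1 i : ~~ perpv om (P i) (P (s i)) by case: (sP i).
have s2 i j : ~~ perpv om (P i) (P j) -> j = s i by move=> h; case: (sP i) =>
  _ /(_ _ h).
have s3 i j : j != s i -> perpv om (P i) (P j).
  by move=> h; apply: contraNT h => /s2/eqP.
have sK i : s (s i) = i by apply/esym/s2; rewrite perpvC.
have sI : injective s by apply: can_inj sK.
have PP i : perpv om (P i) (P i).
  by have [x ->] := dim1_line (P1 i); rewrite /perpv orthov11 om_alt.
have sn i : s i != i.
  by apply/eqP => e; have := s1 i; rewrite e PP.
pose R := [set i : 'I_(\dim {:vT}) | (i < s i)%N]%SET.
have cR : #|R| = n.
  have e : s @: R = ~: R.
    apply/finset.setP => i; rewrite !inE -leqNgt; apply/imsetP/idP.
      by move=> [j + ->]; rewrite inE sK => /ltnW.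
    move=> h; exists (s i) => //; rewrite inE sK ltn_neqAle h andbT //.
    exact: sn.
  have := finset.cardsC R; rewrite -e card_imset // card_ord => cRR.
  by apply/eqP; rewrite -(eqn_pmul2l (m := 2)) // -dimV mul2n -addnn; apply/eqP.
pose r (j : 'I_n) := enum_val (cast_ord (esym cR) j).
have rI : injective r.
  by move=> i j /enum_val_inj /cast_ord_inj.
have rR j : (r j < s (r j))%N by have := enum_valP (cast_ord (esym cR) j);
  rewrite inE.
pose Fr j := (P (r j) + P (s (r j)))%VS.
have pl i : Hgrass om 1 (P i + P (s i))%VS.
  have := s1 i; have [x ->] := dim1_line (P1 i); have [y ->] :=
    dim1_line (P1 (s i)).
  rewrite /perpv orthov11; exact: plane_line2.
have fF : frame om Fr.
  split=> [j|i j ij]; first exact: pl.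
  have n1 : r j != r i by rewrite (inj_eq rI) eq_sym.
  have n2 : r j != s (r i).
    apply/eqP => e; have := rR j; rewrite e sK => h; have := ltn_trans h (rR i).
    by rewrite ltnn.
  have n3 : s (r j) != r i by apply: contraNneq n2 => <-; rewrite sK.
  rewrite /perpv orthovD !orthoDv.
  apply/andP; split; apply/andP; split; apply: s3 => //.
  - by rewrite sK.
  - by rewrite (inj_eq sI).
  - by rewrite sK.
exists Fr => //; apply: fam_base_planes => //.
apply/seteqP; split=> S /=.
  move=> [i [j [/s2 -> ->]]].
  have [iR|iR] := boolP (i \in R).
    exists (cast_ord cR (enum_rank_in iR i)) => //.
    by rewrite /Fr /r cast_ordK enum_rankK_in.
  have iR' : s i \in R.
    by move: iR; rewrite !inE sK -leqNgt ltn_neqAle => ->; rewrite andbT;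
      apply: sn.
  exists (cast_ord cR (enum_rank_in iR' (s i))) => //.
  by rewrite /Fr /r cast_ordK enum_rankK_in // sK addvC.
by move=> [j _ <-]; exists (r j), (s (r j)).
Qed.

End BaseSubsets.

(** * Families of k-subsets and separation *)

Section Separation.
Variables n k : nat.
Implicit Types (I J K : {set 'I_n}) (a b c d i j x y : 'I_n).

Definition sep i j I := (i \in I) (+) (j \in I).

Lemma sepC i j I : sep i j I = sep j i I.
Proof. exact: addbC. Qed.

Lemma sep_trans j i l I : sep i l I = sep j i I (+) sep j l I.
Proof. by rewrite /sep; case: (i \in I); case: (j \in I); case: (l \in I). Qed.

Lemma exists_subset_card I J m : I \subset J -> (#|I| <= m <= #|J|)%N ->
  exists K, [/\ I \subset K, K \subset J & #|K| = m].
Proof.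
move=> IJ /andP[Im]; rewrite -(subnKC Im).
elim: (m - #|I|)%N => [|e IH] lt; first by exists I; rewrite addn0.
have [|K [IK KJ cK]] := IH; first by apply: leq_trans lt; rewrite addnS.
have /fintype.subsetPn[x xJ xK] : ~~ (J \subset K).
  apply/negP => /subset_leq_card; rewrite cK => h.
  by have := leq_trans lt h; rewrite addnS ltnn.
exists (x |: K); split.
- by apply: fintype.subset_trans IK _; apply: finset.subsetU1.
- by apply/fintype.subsetP => y /finset.setU1P[->|/(fintype.subsetP KJ)].
- by rewrite finset.cardsU1 xK cK addnS.
Qed.

(* Compare the members x |: K and y |: K of the family. *)
Lemma odd_count_swap (s : seq 'I_n) x y : (0 < k < n)%N ->
  (forall I, #|I| = k -> ~~ odd (count (mem I) s)) ->
  odd (count_mem x s) = odd (count_mem y s).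
Proof.
move=> /andP[k0 kn] h; have [->//|xy] := eqVneq x y.
have [|K [_ KJ cK]] := @exists_subset_card finset.set0 (~: [set x; y]%SET) k.-1
  (finset.sub0set _).
  rewrite finset.cards0 /= finset.cardsCs finset.setCK finset.cards2 xy
    card_ord.
  by lia.
have cnt z : z \notin K -> odd (count_mem z s) = odd (count (mem K) s).
  move=> zK; have := h (z |: K).
  rewrite finset.cardsU1 zK cK add1n prednK // => /(_ erefl).
  have -> : count (mem (z |: K)%SET) s = (count_mem z s + count (mem K) s)%N.
    rewrite -(@count_predUI _ (pred1 z) (mem K) s).
    rewrite [X in (_ + X)%N](_ : _ = 0%N) ?addn0.
      by apply: eq_count => t /=; rewrite !inE.
    rewrite (eq_count (a2 := pred0)) ?count_pred0 // => t /=.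
    by case: eqVneq => // ->; apply: negbTE.
  by rewrite oddD; case: (odd (count_mem z s)); case: (odd _).
rewrite !cnt //; apply: contraTN isT => zK; have := fintype.subsetP KJ _ zK.
  by rewrite !inE eqxx orbT.
by rewrite !inE eqxx.
Qed.

(** All multiplicities have the same parity, and an index missing from the short list s has
    multiplicity 0. *)
Lemma even_count_mem (s : seq 'I_n) : (0 < k < n)%N -> (size s < n)%N ->
  (forall I, #|I| = k -> ~~ odd (count (mem I) s)) ->
  forall x, ~~ odd (count_mem x s).
Proof.
move=> kn sn h x.
have [y ys] : exists y, y \notin s.
  have /fintype.subsetPn[y _ ys] : ~~ (finset.setT \subset [set y in s]%SET).
    apply/negP => /subset_leq_card; rewrite finset.cardsT card_ord.
    rewrite finset.cardsE => /leq_trans/(_ (card_size s)); by rewrite leqNgt sn.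
  by exists y; rewrite inE in ys.
by rewrite (odd_count_swap x y kn h) (count_memPn ys).
Qed.

(** Disjoint pairs {a, b} and {c, d} would have four indices of odd multiplicity, and {u, v} can
    correct only two. *)
Lemma even_pairs_meet a b c d u v : a != b -> c != d -> u != v ->
  (forall x, ~~ odd (count_mem x [:: a; b; c; d; u; v])) ->
  a \in [:: c; d] \/ b \in [:: c; d].
Proof.
move=> ab cd uv h; apply/orP; move: (h c) (h d) (h a) (h b); rewrite !inE /=.
rewrite !eqxx (negPf ab) (eq_sym b a) (negPf ab) (negPf cd) (eq_sym d c) (negPf
  cd).
rewrite !(eq_sym c) !(eq_sym d).
have [->//|ac] := eqVneq a c; have [->//|ad] := eqVneq a d.
have [->//|bc] := eqVneq b c; have [->//|bd] := eqVneq b d.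
have [uc|uc] := eqVneq u c.
  rewrite uc in uv *; rewrite (negPf cd) eq_sym (negPf uv).
  have [->|vd] := eqVneq v d; last by [].
  by rewrite !(eq_sym _ a) (negPf ac) (negPf ad).
have [vc|vc] := eqVneq v c; last by [].
rewrite vc (negPf cd); have [->|//] := eqVneq u d.
by rewrite !(eq_sym _ a) (negPf ac) (negPf ad).
Qed.

Lemma sep_inj i j l : (0 < k)%N -> (k.+2 <= n)%N -> j != l -> i != l ->
  exists2 I : {set 'I_n}, #|I| = k & sep i j I != sep i l I.
Proof.
move=> k0 kn jl il.
have [||I [jI IJ cI]] := @exists_subset_card [set j]%SET (~: [set l]%SET) k.
- by rewrite finset.sub1set !inE.
- rewrite finset.cards1 k0 /= finset.cardsCs finset.setCK finset.cards1
    card_ord.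
  by lia.
exists I => //; rewrite /sep.
have -> : j \in I by apply: (fintype.subsetP jI); rewrite inE.
have -> : l \in I = false.
  by apply/negP => /(fintype.subsetP IJ); rewrite !inE eqxx.
by case: (i \in I).
Qed.

(** A permutation s taking i to i' and j to j' carries one family into the other. *)
Lemma card_unseparated_le i j i' j' : i != j -> i' != j' ->
  (#|[set I : {set 'I_n} | (#|I| == k) && ~~ sep i j I]%SET| <=
   #|[set I : {set 'I_n} | (#|I| == k) && ~~ sep i' j' I]%SET|)%N.
Proof.
move=> ij ij'; pose t := tperm i i'.
pose s := (t * tperm (t j) j')%g.
have sj : s j = j' by rewrite permM tpermL.
have ti : t i = i' by rewrite tpermL.
have si : s i = i'.
  rewrite permM ti tpermD // eq_sym //; rewrite -ti (inj_eq perm_inj) //.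
have imI := finset.imset_inj (@perm_inj _ s).
rewrite -(card_imset _ imI).
apply/subset_leq_card/fintype.subsetP => _ /imsetP[I + ->].
rewrite !inE card_imset; last exact: perm_inj.
by rewrite /sep -si -sj !mem_imset //; apply: perm_inj.
Qed.

Lemma eq_unseparated (phi : {set 'I_n} -> {set 'I_n}) i j i' j' :
    i != j -> i' != j' ->
    (forall I J, #|I| = k -> #|J| = k -> phi I = phi J -> I = J) ->
    (forall I, #|I| = k -> #|phi I| = k) ->
    (forall I, #|I| = k -> ~~ sep i j I -> ~~ sep i' j' (phi I)) ->
  forall I, #|I| = k -> sep i j I = sep i' j' (phi I).
Proof.
move=> ij ij' inj hk h I cI; apply/idP/idP => [|];
  last exact: contraTT (h I cI).
apply: contraTT => nI.
pose N i j := [set I : {set 'I_n} | (#|I| == k) && ~~ sep i j I]%SET.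
have inj' : {in N i j &, injective phi}.
  move=> J K; rewrite !inE => /andP[/eqP cJ _] /andP[/eqP cK _]; exact: inj.
have : phi @: N i j == N i' j'.
  rewrite eqEcard card_in_imset // card_unseparated_le // andbT.
  apply/fintype.subsetP => _ /imsetP[J + ->]; rewrite !inE => /andP[/eqP cJ nJ].
  by rewrite hk // eqxx h.
move=> /eqP/finset.setP/(_ (phi I)); rewrite [in RHS]inE hk // eqxx nI.
move=> /imsetP[J]; rewrite inE => /andP[/eqP cJ nJ] /inj e.
by rewrite e.
Qed.

Variable phi : {set 'I_n} -> {set 'I_n}.
Hypothesis kn : (1 < k)%N.
Hypothesis kn4 : (k + 4 <= n)%N.
Hypothesis n7 : (6 < n)%N.
Hypothesis phi_surj : forall J, #|J| = k -> exists2 I : {set 'I_n},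
  #|I| = k & phi I = J.
Hypothesis phi_edge : forall i j, i != j -> exists i' j', i' != j' /\
  forall I, #|I| = k -> sep i j I = sep i' j' (phi I).

Let k_gt0 : (0 < k)%N := ltnW kn.
Let k_lt : (0 < k < n)%N.
Proof. by rewrite k_gt0 (leq_trans _ kn4) // addnS ltnS leq_addr. Qed.

Let is_image p q i j := forall I, #|I| = k -> sep i j I = sep p q (phi I).

(** The separations of {i, j}, {i, l} and {j, l} add up to zero modulo 2, hence so do those of their
    images; the six entries of the image pairs are fewer than n, so the parity lemma applies. *)
Lemma edge_image_meet i j l a b c d : j != l ->
  a != b -> c != d -> is_image a b i j -> is_image c d i l ->
  a \in [:: c; d] \/ b \in [:: c; d].
Proof.
move=> jl ab cd h1 h2; have [u [v [uv h3]]] := phi_edge jl.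
apply: (even_pairs_meet ab cd uv); apply: even_count_mem => // J cJ.
have [I cI <-] := phi_surj cJ.
have := sep_trans i j l I; rewrite h1 // h2 // h3 // /sep /=.
by do 6! case: (_ \in _).
Qed.

(* The separations of three pairs sum to zero modulo 2 only if the pairs form a
   triangle; hence the images of the pairs {i0, j} all share one index p, which
   is the image of i0. *)
Lemma edge_map_perm : exists2 p : 'I_n -> 'I_n, injective p &
  forall I, #|I| = k -> forall i j, sep i j I = sep (p i) (p j) (phi I).
Proof.
have o (m : nat) : (m < 7)%N -> (m < n)%N by move=> /leq_trans; apply.
pose i0 : 'I_n := Ordinal (o 0%N isT); pose i1 : 'I_n := Ordinal (o 1%N isT).
pose i2 : 'I_n := Ordinal (o 2%N isT).
have [p [q1 [q2 [pq1 pq2 h1 h2]]]] : exists p q1 q2, [/\ p != q1, p != q2,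
    is_image p q1 i0 i1 & is_image p q2 i0 i2].
  have [a [b [ab h1]]] := phi_edge (isT : i0 != i1).
  have [c [d [cd h2]]] := phi_edge (isT : i0 != i2).
  have sw x y i j : is_image x y i j -> is_image y x i j.
    by move=> h I cI; rewrite h // sepC.
  have [|] := edge_image_meet (isT : i1 != i2) ab cd h1 h2; rewrite !inE =>
    /pred2P[] e.
  - by exists a, b, d; rewrite ab e; split=> //; rewrite -e.
  - by exists a, b, c; rewrite ab e eq_sym; split=> //;
      [rewrite -e | apply: sw].
  - by exists b, a, d; rewrite eq_sym ab e; split=> //; rewrite -e; apply: sw.
  - by exists b, a, c; rewrite eq_sym ab e eq_sym; split=> //;
      [rewrite -e; apply: sw | apply: sw].
have /choice[pi piP] j : exists q, is_image p q i0 j.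
  have [<-|i0j] := eqVneq i0 j; first by exists p => I _; rewrite /sep !addbb.
  have [<-|i1j] := eqVneq i1 j; first by exists q1.
  have [<-|i2j] := eqVneq i2 j; first by exists q2.
  have [c [d [cd h]]] := phi_edge i0j.
  have h' : is_image d c i0 j by move=> I cI; rewrite h // sepC.
  have [->|pc] := eqVneq p c; first by exists d.
  have [->|pd] := eqVneq p d; first by exists c.
  have q12 : q1 != q2.
    apply: contraTneq isT => e.
    have [||||I cI] := @sep_inj i0 i1 i2; rewrite ?k_gt0 //; try lia.
    by rewrite h1 // h2 // e eqxx.
  have q1c : q1 \in [:: c; d].
    have [|//] := edge_image_meet i1j pq1 cd h1 h.
    by rewrite !inE (negPf pc) (negPf pd).
  have q2c : q2 \in [:: c; d].
    have [|//] := edge_image_meet i2j pq2 cd h2 h.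
    by rewrite !inE (negPf pc) (negPf pd).
  (* the image of {i0, j} would be that of {i1, i2} *)
  have e I : #|I| = k -> sep i0 j I = sep i1 i2 I.
    move=> cI; rewrite [RHS](sep_trans i0) h1 // h2 // h //.
    move: q1c q2c q12; rewrite !inE /sep => /pred2P[] -> /pred2P[] ->;
      rewrite ?eqxx //; by case: (p \in _); case: (c \in _); case: (d \in _).
  (* A k-set containing i0 but none of j, i1, i2 separates i0 from j without separating i1 from i2;
     there is room for it since k <= n - 3. *)
  have [||I [iI IJ cI]] := @exists_subset_card [set i0]%SET (~: [set j; i1;
    i2]%SET) k.
  - by rewrite finset.sub1set !inE (negPf i0j).
  - have := finset.cardsC [set j; i1; i2]%SET; rewrite finset.cards1 card_ord.
    have := finset.cardsU1 j [set i1; i2]%SET;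
      rewrite finset.cards2 -finset.setUA.
    move=> ->; case: (j \notin _); case: (i1 != i2); move: #|_| => x;
      clear -kn kn4; lia.
  have out x : x \in [set j; i1; i2]%SET -> x \in I = false.
    by move=> xJ; apply/negP => /(fintype.subsetP IJ); rewrite inE xJ.
  have := e _ cI; rewrite /sep (out j) ?(out i1) ?(out i2) ?inE ?eqxx ?orbT //.
  by rewrite (fintype.subsetP iI) ?inE.
have pi_sep I : #|I| = k -> forall i j, sep i j I = sep (pi i) (pi j) (phi I).
  move=> cI i j; rewrite (sep_trans i0) [RHS](sep_trans p).
  by rewrite !piP.
exists pi => // i j e; apply/eqP; apply: contraTT isT => ij.
have [||||I cI] := @sep_inj i i j; rewrite ?k_gt0 //; try lia.
by rewrite !(pi_sep _ cI) e eqxx.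
Qed.

End Separation.

(** * The action on frames *)

Section FrameMaps.
Variables (F : fieldType) (vT : vectType F) (om : {skew_symmetric vT}).
Hypothesis sympl : is_psymplectic om.
Variable n : nat.
Hypothesis dimV : \dim {:vT} = (2 * n)%N.
Implicit Types (Fr G : 'I_n -> {vspace vT}) (I J K : {set 'I_n}).
Implicit Types (S T U W : {vspace vT}) (f : {vspace vT} -> {vspace vT}).

Local Notation perp := (orthov om).
Local Notation plane := (Hgrass om 1).
Local Notation frame := (frame om).

Lemma fsum_imset G (p : 'I_n -> 'I_n) I :
  injective p -> fsum G (p @: I) = fsum (G \o p) I.
Proof. by move=> pI; rewrite /fsum big_imset //= => i j _ _ /pI. Qed.

Lemma frame_comp G (p : 'I_n -> 'I_n) : injective p -> frame G ->
  frame (G \o p).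
Proof.
move=> pI [h1 h2]; split=> [i|i j ij]; first exact: h1.
by apply: h2; rewrite (inj_eq pI).
Qed.

(* Each plane of G is an intersection of members of the common part and of their
   orthogonal complements, hence a sum of planes of G', hence one of them. *)
Lemma fam_sub_separating k G G' : frame G -> frame G' ->
    (forall i j, i != j -> exists2 J, sep i j J & fam k G' (fsum G J)) ->
  (fam k G' `<=` fam k G)%classic.
Proof.
move=> fG fG' sp.
pose L K := exists K', fsum G K = fsum G' K'.
have LI K J : L K -> L J -> L (K :&: J).
  move=> [K' eK] [J' eJ]; exists (K' :&: J').
  by rewrite !(fsumI sympl dimV) // eK eJ.
have LC K : L K -> L (~: K).
  move=> [K' eK]; exists (~: K').
  by rewrite -!(perp_fsum sympl dimV) // eK.
have LT : L finset.setT by exists finset.setT;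
  rewrite (fsumT dimV fG) (fsumT dimV fG').
have /choice[s sP] i : exists l, G i = G' l.
  have /choice[J JP] j : exists J, [/\ L J, i \in J & i != j -> j \notin J].
    have [->|ij] := eqVneq i j; first by exists finset.setT; rewrite inE.
    have [J sJ [J' _ eJ]] := sp i j ij.
    have LJ : L J by exists J'.
    move: sJ; rewrite /sep; have [iJ /= jJ|iJ /= jJ] := boolP (i \in J).
      by exists J.
    by exists (~: J); rewrite !inE iJ jJ; split=> //; apply: LC.
  have Li : L (\bigcap_j J j)%SET.
    by apply: (big_ind L) => // j _; case: (JP j).
  have [K' eK] := Li.
  have iE : (\bigcap_j J j)%SET = [set i]%SET.
    apply/finset.setP => j; rewrite inE; apply/finset.bigcapP/eqP => [h|-> l _].
      apply/eqP; apply: contraTT isT; rewrite eq_sym => ij.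
      by have [_ _ /(_ ij)] := JP j; rewrite h.
    by case: (JP l).
  move: eK; rewrite iE fsum1 => eK.
  have : #|K'| == 1%N.
    rewrite -(eqn_pmul2l (m := 2)) // -(dim_fsum _ fG') -eK.
    by case: fG => /(_ i)[->].
  by move=> /cards1P[l e]; exists l; rewrite eK e fsum1.
have sI : injective s.
  by move=> i j e; apply: (frame_inj sympl dimV fG); rewrite !sP e.
have [t sK tK] := injF_bij sI.
move=> _ [I cI ->]; exists (t @: I); first by rewrite card_imset //;
  apply: can_inj tK.
have -> : fsum G (t @: I) = fsum (G' \o s) (t @: I).
  by apply: eq_fsum => i _; apply: sP.
rewrite -fsum_imset // -finset.imset_comp.
by congr (fsum _ _); apply/esym; rewrite (finset.eq_imset (g :=
  id)) ?finset.imset_id.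
Qed.

(* The sum of the planes i and j is split in another way. *)
Lemma frame_twist k Fr i j : (0 < k < n)%N -> frame Fr -> i != j ->
  exists Fr', [/\ frame Fr', ~ (fam k Fr' `<=` fam k Fr)%classic &
    forall I, ~~ sep i j I -> fsum Fr' I = fsum Fr I].
Proof.
move=> /andP[k0 kn] fF ij; have [pF oF] := fF.
have [x [y [xy eFi]]] := planeP sympl (pF i).
have [z [w [zw eFj]]] := planeP sympl (pF j).
have xi : x \in Fr i by rewrite eFi memv_line2l.
have yi : y \in Fr i by rewrite eFi memv_line2r.
have zj : z \in Fr j by rewrite eFj memv_line2l.
have wj : w \in Fr j by rewrite eFj memv_line2r.
have o a b : a \in Fr i -> b \in Fr j -> om a b = 0.
  exact: (perpvP _ _ _ (oF i j ij)).
(* A plane inside [Fr i + Fr j] different from both: x + z is not orthogonal to w, so it is not in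
   [Fr i]; y is not orthogonal to x, so it is not in [Fr j]. *)
pose T := (<[(x + z)]> + <[y]>)%VS.
have zy : om z y = 0 by apply/eqP; rewrite (om_eq0C om) o.
have pT : plane T by apply: plane_line2 => //;
  rewrite omDl xy zy addr0 oner_neq0.
have TF : (T <= Fr i + Fr j)%VS.
  by rewrite line2_sub memv_add //= (subvP (addvSl _ _)).
pose Fr0 l := if l == i then T else Fr l.
have oT l : l != i -> l != j -> perpv om T (Fr l).
  move=> li lj; apply: (subv_trans TF).
  by rewrite subv_add; apply/andP; split; apply: oF; rewrite eq_sym.
(* Index j is left free: what the extension puts there is forced to be the orthogonal complement of
   T in [Fr i + Fr j]. *)
have [|Fr' fF' eF'] := @frame_extend _ _ om sympl n dimV (~: [set j]) Fr0.
  split=> [l|l m]; rewrite !inE /Fr0; first by case: ifP.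
  have [->|li] := eqVneq l i; have [->|mi] := eqVneq m i => lj mj lm.
  - by [].
  - exact: oT.
  - by rewrite perpvC; apply: oT.
  - exact: oF.
have eF'l l : l != i -> l != j -> Fr' l = Fr l.
  by move=> li lj; rewrite eF' ?inE // /Fr0 (negPf li).
have F'i : Fr' i = T by rewrite eF' ?inE // /Fr0 eqxx.
have eout I : i \notin I -> j \notin I -> fsum Fr' I = fsum Fr I.
  move=> iI jI; apply: eq_fsum => l lI; apply: eF'l.
    by apply: contraTneq lI => ->.
  by apply: contraTneq lI => ->.
have esep I : ~~ sep i j I -> fsum Fr' I = fsum Fr I.
  rewrite /sep; have [iI /negPn jI|iI jI] := boolP (i \in I); last exact: eout.
  rewrite -[I]finset.setCK -(perp_fsum sympl dimV _ fF') -(perp_fsum sympl dimV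
    _ fF).
  by rewrite eout // !inE ?iI ?jI.
exists Fr'; split=> // sub.
have [||I [iI IJ cI]] := @exists_subset_card n [set i]%SET (~: [set j]%SET) k.
- by rewrite finset.sub1set !inE.
- by rewrite finset.cards1 k0 /= finset.cardsCs finset.setCK finset.cards1
    card_ord; lia.
have iI' : i \in I by rewrite (fintype.subsetP iI) ?inE.
have jI : j \notin I by apply/negP => /(fintype.subsetP IJ); rewrite !inE eqxx.
have [J _ eJ] : fam k Fr (fsum Fr' I) by apply: sub; exists I.
have eij : fsum Fr' [set i; j]%SET = fsum Fr [set i; j]%SET.
  by apply: esep; rewrite /sep !inE !eqxx orbT.
(* The member I of [Fr'] meets the sum of the planes i and j in T. Were it also a member for [Fr], T
   would be a sum of planes among [Fr i] and [Fr j], hence one of the two. *)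
have e : T = fsum Fr (J :&: [set i; j]).
  rewrite (fsumI sympl dimV) // -eJ -eij -(fsumI sympl dimV) // -F'i -fsum1.
  congr (fsum _ _); apply/finset.setP => l; rewrite !inE.
  have [->|li] := eqVneq l i; first by rewrite iI'.
  by have [->|lj] := eqVneq l j; rewrite ?(negPf jI) ?andbF.
have : #|J :&: [set i; j]| == 1%N.
  rewrite -(eqn_pmul2l (m := 2)) // -(dim_fsum _ fF) -e.
  by case: pT => ->.
have xzT : x + z \in T by apply: memv_line2l.
have yT : y \in T by apply: memv_line2r.
move=> /cards1P[l el]; have : l \in J :&: [set i; j] by rewrite el inE.
rewrite finset.in_setI finset.in_set2 => /andP[_ lij].
move: e xzT yT; rewrite el fsum1 => -> xzT yT; case/pred2P: lij => lE.
  move: xzT; rewrite lE => /o/(_ wj)/eqP.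
  by rewrite omDl o // add0r zw oner_eq0.
by move: yT; rewrite lE => /(o x y xi)/eqP; rewrite xy oner_eq0.
Qed.

(** Stated for one map without reference to its inverse, so that every consequence applies to f and
    to f' alike. *)
Definition base_map k f :=
  [/\ forall U, Hgrass om k U -> Hgrass om k (f U),
      forall U W, Hgrass om k U -> Hgrass om k W -> f U = f W -> U = W
    & forall Fr : 'I_n -> {vspace vT}, frame Fr ->
        exists2 G : 'I_n -> {vspace vT}, frame G &
          (f @` fam k Fr)%classic = fam k G].

(** The alternative is chosen for each I separately; nothing is assumed to tie these choices
    together. *)
Definition match_frames k f Fr G :=
  forall I : {set 'I_n}, #|I| = k ->
    f (fsum Fr I) = fsum G I \/ f (fsum Fr I) = fsum G (~: I).

Lemma fam_Hgrass k Fr U : frame Fr -> fam k Fr U -> Hgrass om k U.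
Proof. by move=> fF [I <- ->]; apply: frame_Hgrass. Qed.

(** On the frame, f permutes the k-sets by [phi], and [phi] respects separation up to an injection p
    of the indices. A set being determined up to complement by the pairs it separates, [phi I] is
    the image of I under p or the complement of that image. *)
Lemma match_exists k f Fr : (1 < k)%N -> (k + 4 <= n)%N -> (6 < n)%N ->
  base_map k f -> frame Fr ->
  exists2 G : 'I_n -> {vspace vT}, frame G & match_frames k f Fr G.
Proof.
move=> k1 kn n7 [fH fI fB] fF; have [G fG eG] := fB _ fF.
have HF I : #|I| = k -> Hgrass om k (fsum Fr I).
  by move=> <-; apply: frame_Hgrass.
have /choice[phi phiP] I : exists J, #|I| = k ->
  #|J| = k /\ f (fsum Fr I) = fsum G J.
  have [cI|cI] := eqVneq #|I| k; last by exists I => /eqP; rewrite (negPf cI).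
  have [J cJ e] : fam k G (f (fsum Fr I)) by rewrite -eG; exists (fsum Fr I) =>
    //; exists I.
  by exists J.
have phi_card I : #|I| = k -> #|phi I| = k by move=> /phiP[].
have phiE I : #|I| = k -> f (fsum Fr I) = fsum G (phi I) by move=> /phiP[].
have phi_inj I J : #|I| = k -> #|J| = k -> phi I = phi J -> I = J.
  move=> cI cJ e; apply: (fsum_inj sympl dimV fF); apply: fI; try exact: HF.
  by rewrite !phiE // e.
have phi_surj J : #|J| = k -> exists2 I : {set 'I_n}, #|I| = k & phi I = J.
  move=> cJ; have : fam k G (fsum G J) by exists J.
  rewrite -eG => -[_ [I cI ->] e]; exists I => //.
  by apply: (fsum_inj sympl dimV fG); rewrite -phiE.
have phi_edge i j : i != j -> exists i' j', i' != j' /\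
    forall I, #|I| = k -> sep i j I = sep i' j' (phi I).
  move=> ij; have k0n : (0 < k < n)%N by lia.
  have [Fr' [fF' nsub eF']] := frame_twist k0n fF ij.
  have [G' fG' eG'] := fB _ fF'.
  have [i' [j' [ij' h]]] : exists i' j', i' != j' /\
      forall I, #|I| = k -> ~~ sep i j I -> ~~ sep i' j' (phi I).
    (* Otherwise the images of the members common to [Fr] and its twist [Fr'] separate all pairs of
       G, so the image of [fam k Fr'] lies in that of [fam k Fr]; injectivity of f then contradicts
       the choice of [Fr']. *)
    apply: contrapT => nh; apply: nsub => U FU.
    have : fam k G (f U).
      apply: (@fam_sub_separating k G G') => //; last by rewrite -eG'; exists U.
      move=> i' j' ij'; apply: contrapT => nJ; apply: nh; exists i', j'; split=>
        // I cI nI.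
      apply/negP => sI; apply: nJ; exists (phi I) => //.
      by rewrite -phiE // -eF' // -eG'; exists (fsum Fr' I) => //; exists I.
    rewrite -eG => -[W FW /fI <-] //; last exact: fam_Hgrass FU.
    exact: fam_Hgrass FW.
  exists i', j'; split=> // I cI.
  exact: eq_unseparated phi_inj phi_card h _ cI.
have [p pI pE] := edge_map_perm k1 kn n7 phi_surj phi_edge.
exists (G \o p); first exact: frame_comp.
have [q pK qK] := injF_bij pI.
have mp I i : (p i \in p @: I) = (i \in I) by apply: mem_imset.
move=> I cI; rewrite -[fsum (G \o p) I]fsum_imset //
  -[fsum (G \o p) (~: I)]fsum_imset // phiE //.
pose i0 : 'I_n := Ordinal (leq_ltn_trans (leq0n 6) n7).
(* The reference index i0 decides between the set and its complement. *)
have h j : (j \in phi I) = (p i0 \in phi I) (+) (i0 \in I) (+) (j \in p @: I).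
  rewrite -{1 2}[j]qK mp; have := pE _ cI i0 (q j); rewrite /sep.
  by case: (p i0 \in _); case: (i0 \in _); case: (p (q j) \in _);
    case: (q j \in _).
case: (boolP (_ (+) _)) h => _ h; [right|left]; congr (fsum _ _);
  apply/finset.setP => j; rewrite h //.
by rewrite -[j]qK !mp ?inE; case: (_ \in _).
Qed.

End FrameMaps.

(** * Frames with a large common part have the same image there *)

Section FrameAgreement.
Variables (F : fieldType) (vT : vectType F) (om : {skew_symmetric vT}).
Hypothesis sympl : is_psymplectic om.
Variables n k : nat.
Hypothesis dimV : \dim {:vT} = (2 * n)%N.
Hypothesis n2k : n = (2 * k)%N.
Hypothesis n14 : (14 <= n)%N.
Implicit Types (Fr G : 'I_n -> {vspace vT}) (I J K : {set 'I_n}).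
Implicit Types (S T U W : {vspace vT}) (f : {vspace vT} -> {vspace vT}).

Local Notation perp := (orthov om).
Local Notation plane := (Hgrass om 1).
Local Notation frame := (frame om).

(** The symmetric difference in lattice terms. Replacing an argument by its orthogonal complement
    only complements the result, so it can be computed from members known up to complement. *)
Definition symdiffv U W : {vspace vT} := ((U :&: perp W) + (perp U :&: W))%VS.
Definition symdiffs I J : {set 'I_n} := (I :&: ~: J) :|: (~: I :&: J).

Lemma symdiffsCl I J : symdiffs (~: I) J = ~: symdiffs I J.
Proof. by apply/finset.setP => l; rewrite !inE; case: (l \in I);
  case: (l \in J). Qed.

Lemma symdiffsCr I J : symdiffs I (~: J) = ~: symdiffs I J.
Proof. by apply/finset.setP => l; rewrite !inE; case: (l \in I);
  case: (l \in J). Qed.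

Lemma symdiffv_fsum G I J : frame G ->
  symdiffv (fsum G I) (fsum G J) = fsum G (symdiffs I J).
Proof.
by move=> fG; rewrite /symdiffv !(perp_fsum sympl dimV _ fG) -!(fsumI sympl
  dimV) // -fsumU.
Qed.

(** A k-set inside J has one image for both frames, so the members of G and G' agree up to
    complement. Two k-sets in J differing by an exchange of i and j recover the sum of the planes i
    and j; a plane is the intersection of two such sums, for which J has enough indices. *)
Lemma match_agree_large f Fr Fr' G G' J :
    frame Fr -> frame Fr' -> frame G -> frame G' ->
    match_frames k f Fr G -> match_frames k f Fr' G' ->
    (k < #|J|)%N -> {in J, Fr =1 Fr'} -> {in J, G =1 G'}.
Proof.
move=> fF fF' fG fG' m m' cJ e.
have same I : I \subset J -> #|I| = k ->
    fsum G I = fsum G' I \/ fsum G I = fsum G' (~: I).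
  move=> IJ cI; have eI : fsum Fr I = fsum Fr' I.
    by apply: eq_fsum => i /(fintype.subsetP IJ); apply: e.
  have := m _ cI; have := m' _ cI; rewrite eI => -[->|->] [h|h];
    try by [left|right].
    by right; rewrite -(perp_fsum sympl dimV _ fG') h (perp_fsum sympl dimV _
      fG) finset.setCK.
  by left; rewrite -[I]finset.setCK -(perp_fsum sympl dimV _ fG') h (perp_fsum
    sympl dimV _ fG).
have pair i j : i \in J -> j \in J -> i != j ->
    fsum G [set i; j]%SET = fsum G' [set i; j]%SET.
  move=> iJ jJ ij; have ji : j != i by rewrite eq_sym.
  have [||K [_ KJ cK]] := @exists_subset_card n finset.set0 (J :\ i :\ j) k.-1.
  - exact: finset.sub0set.
  - rewrite finset.cards0 /=.
    have := finset.cardsD1 i J; have := finset.cardsD1 j (J :\ i).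
    by rewrite !inE ji iJ jJ /=; move: #|_| #|_| #|_| cJ; lia.
  have KJ' : K \subset J.
    by apply/fintype.subsetP => l /(fintype.subsetP KJ); rewrite !inE =>
      /and3P[].
  have [iK jK] : i \notin K /\ j \notin K.
    by split; apply/negP => /(fintype.subsetP KJ); rewrite !inE eqxx ?andbF.
  have cU l : l \notin K -> #|l |: K| = k.
    by move=> lK; rewrite finset.cardsU1 lK cK; lia.
  have sU l : l \in J -> l |: K \subset J.
    by move=> lJ; rewrite finset.subUset finset.sub1set lJ.
  have sd : symdiffs (i |: K) (j |: K) = [set i; j]%SET.
    apply/finset.setP => l; rewrite !inE.
    have [->|li] := eqVneq l i; first by rewrite (negPf ij) (negPf iK).
    have [->|lj] := eqVneq l j; first by rewrite (negPf jK).
    by case: (l \in K).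
  rewrite -sd -!symdiffv_fsum //.
  (* Dimension 4 on the left, 2n - 4 on the right. *)
  have bad : fsum G (symdiffs (i |: K) (j |: K)) <> fsum G' (~: symdiffs (i |:
    K) (j |: K)).
    rewrite sd => /(congr1 (fun U => \dim U)).
    rewrite (dim_fsum _ fG) (dim_fsum _ fG') finset.cards2 ij finset.cardsCs
      finset.setCK finset.cards2 ij card_ord.
    lia.
  have [eI|eI] := same _ (sU i iJ) (cU i iK);
  have [eJ|eJ] := same _ (sU j jJ) (cU j jK).
  - by rewrite eI eJ.
  - by case: bad; rewrite -symdiffv_fsum // eI eJ symdiffv_fsum // symdiffsCr.
  - by case: bad; rewrite -symdiffv_fsum // eI eJ symdiffv_fsum // symdiffsCl.
  by rewrite eI eJ !symdiffv_fsum // symdiffsCl symdiffsCr finset.setCK.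
move=> i iJ; have /card_gt1P[j [l [jJ lJ jl]]] : (1 < #|J :\ i|)%N.
  by have := finset.cardsD1 i J; rewrite iJ; move: cJ; move: #|_| #|_|; lia.
move: jJ lJ; rewrite !inE => /andP[ji jJ] /andP[li lJ].
have -> : G i = (fsum G [set i; j]%SET :&: fsum G [set i; l]%SET)%VS.
  rewrite -(fsumI sympl dimV) // -fsum1; congr (fsum _ _); apply/finset.setP =>
    m0.
  rewrite !inE; have [->//|mi] := eqVneq m0 i.
  by have [->|] := eqVneq m0 j; rewrite ?(negPf jl).
rewrite !pair // 1?eq_sym // -(fsumI sympl dimV) // -[RHS]fsum1;
  congr (fsum _ _).
apply/finset.setP => m0.
rewrite !inE; have [->//|mi] := eqVneq m0 i.
by have [->|] := eqVneq m0 j; rewrite ?(negPf jl).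
Qed.

End FrameAgreement.

(** * The induced map on planes *)

Section PlaneMap.
Variables (F : fieldType) (vT : vectType F) (om : {skew_symmetric vT}).
Hypothesis sympl : is_psymplectic om.
Variables n k : nat.
Hypothesis dimV : \dim {:vT} = (2 * n)%N.
Hypothesis n2k : n = (2 * k)%N.
Hypothesis n14 : (14 <= n)%N.
Implicit Types (Fr G : 'I_n -> {vspace vT}) (I J K : {set 'I_n}).
Implicit Types (S T U W : {vspace vT}) (f : {vspace vT} -> {vspace vT}).

Local Notation perp := (orthov om).
Local Notation plane := (Hgrass om 1).
Local Notation frame := (frame om).

(** If there is none, [Z] is totally isotropic. It then lies in A + S + T and in [perp A], hence in
    S + T, of dimension at most 4; but its dimension is at least 4k - 2k - 4. *)
Lemma plane_perp_common A S T : nondegenerate_on om A -> plane S -> plane T ->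
  (\dim A <= 2 * k)%N -> (S <= perp A)%VS -> (T <= perp A)%VS ->
  exists2 W, plane W & (W <= perp (A + (S + T)))%VS.
Proof.
move=> ndA [dS _] [dT _] dA SA TA; apply: (sub_plane sympl).
rewrite (perpK sympl); set Z := perp _; apply/negP => ZB.
have dB : (\dim (S + T) <= 4)%N by have := dimv_sum_cap S T; rewrite dS dT; lia.
have dZ := dim_perp sympl (A + (S + T))%VS; rewrite -/Z dimV in dZ.
have dAB : (\dim (A + (S + T)) <= \dim A + \dim (S + T))%N.
  by rewrite -dimv_sum_cap leq_addr.
have : (Z <= S + T)%VS.
  have -> : (S + T = perp A :&: (A + (S + T)))%VS.
    have STA : (S + T <= perp A)%VS by rewrite subv_add SA TA.
    by rewrite -(vspace_modr A STA) [(perp A :&: A)%VS]capvC (nd_cap ndA) add0v.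
  by rewrite subv_cap ZB andbT perpS // addvSl.
move=> /dimvS; lia.
Qed.

(* Downward induction on #|J|: with j outside J and W a plane orthogonal to
   Fr j, Fr' j and to the planes of J, go from Fr to Fr' through frames which
   agree successively on J and j, on J and W, on J and j. *)
Lemma match_agree f Fr Fr' G G' J : base_map om n k f ->
    frame Fr -> frame Fr' -> frame G -> frame G' ->
    match_frames k f Fr G -> match_frames k f Fr' G' ->
  {in J, Fr =1 Fr'} -> {in J, G =1 G'}.
Proof.
move=> fB; have [m] := ubnP (n - #|J|); elim: m J Fr Fr' G G' => //
  m IH J Fr Fr' G G' lt.
move=> fF fF' fG fG' mm mm' e.
have [cJ|cJ] := ltnP k #|J|; first exact: (match_agree_large sympl dimV n2k n14
  fF fF' fG fG' mm mm' cJ e).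
have /finset.set0Pn[j] : ~: J != finset.set0.
  by rewrite -finset.card_gt0 finset.cardsCs finset.setCK card_ord; lia.
rewrite inE => jJ; have cjJ : #|j |: J| = #|J|.+1 by rewrite finset.cardsU1 jJ.
have /finset.set0Pn[l] : ~: (j |: J) != finset.set0.
  by rewrite -finset.card_gt0 finset.cardsCs finset.setCK card_ord cjJ; lia.
rewrite inE => ljJ; have lJ : l \notin J by apply: contraNN ljJ => lJ;
  rewrite !inE lJ orbT.
have clJ : #|l |: J| = #|J|.+1 by rewrite finset.cardsU1 lJ.
have eA : fsum Fr J = fsum Fr' J by apply: eq_fsum.
have [dA ndA] := frame_Hgrass J fF.
have perpA (H : 'I_n -> {vspace vT}) : frame H -> (H j <= perp (fsum H J))%VS.
  by move=> fH; rewrite (perp_fsum sympl dimV) // fsum_sup // inE.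
have [|||||W pW] := @plane_perp_common (fsum Fr J) (Fr j) (Fr' j) ndA.
- by case: fF => h _; apply: h.
- by case: fF' => h _; apply: h.
- by rewrite dA; lia.
- exact: perpA.
- by rewrite eA; apply: perpA.
rewrite addvA => WP.
have [|F1 [fF1 eF1 F1l]] := frame_replace sympl dimV fF ljJ pW.
  by apply: subv_trans WP _; apply: perpS; rewrite fsumU fsum1 addvC addvSl.
have [|F2 [fF2 eF2 F2l]] := frame_replace sympl dimV fF' ljJ pW.
  apply: subv_trans WP _; apply: perpS; rewrite fsumU fsum1 -eA addvC.
  by rewrite addvS // addvSl.
have [||| G1 fG1 m1] := match_exists sympl dimV _ _ _ fB fF1; try lia.
have [||| G2 fG2 m2] := match_exists sympl dimV _ _ _ fB fF2; try lia.
have sub x : x \in J -> x \in j |: J by rewrite !inE => ->; rewrite orbT.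
have sub' x : x \in J -> x \in l |: J by rewrite !inE => ->; rewrite orbT.
have ltj : (n - #|j |: J| < m)%N by rewrite cjJ; lia.
have ltl : (n - #|l |: J| < m)%N by rewrite clJ; lia.
move=> x xJ.
rewrite (IH _ _ _ _ _ ltj fF fF1 fG fG1 mm m1) ?sub //; last first.
  by move=> y yJ; rewrite eF1.
rewrite (IH _ _ _ _ _ ltl fF1 fF2 fG1 fG2 m1 m2) ?sub' //; last first.
  move=> y; rewrite !inE => /predU1P[->|yJ]; first by rewrite F1l F2l.
  by rewrite eF1 ?eF2 ?sub // e.
rewrite (IH _ _ _ _ _ ltj fF2 fF' fG2 fG' m2 mm') ?sub //.
Qed.

Lemma imset_setC (p : 'I_n -> 'I_n) I : injective p ->
  p @: (~: I) = ~: (p @: I).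
Proof.
move=> pI; have [q pK qK] := injF_bij pI; apply/finset.setP => j.
by rewrite -[j]qK inE !mem_imset // inE.
Qed.

Lemma match_comp f Fr G (p : 'I_n -> 'I_n) : injective p ->
  match_frames k f Fr G -> match_frames k f (Fr \o p) (G \o p).
Proof.
move=> pI m I cI; rewrite -[fsum (Fr \o p) I]fsum_imset //
  -[fsum (G \o p) I]fsum_imset //.
rewrite -[fsum (G \o p) (~: I)]fsum_imset // imset_setC //.
by apply: m; rewrite card_imset.
Qed.

Lemma plane_frame (i : 'I_n) S : plane S -> exists2 Fr, frame Fr & Fr i = S.
Proof.
move=> pS; have [|Fr fF e] := @frame_extend _ _ _ sympl _ dimV [set i] (fun=>
  S).
  by split=> // j l /finset.set1P-> /finset.set1P->; rewrite eqxx.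
by exists Fr => //; rewrite e // inE.
Qed.

(** The value at S is read off one frame having S at the index i0. Any other frame through S is
    reindexed by a transposition to have S at i0 too, and agreement on this single index is
    enough. *)
Lemma plane_map_exists f : base_map om n k f -> exists g : {vspace vT} ->
  {vspace vT},
  forall Fr G, frame Fr -> frame G -> match_frames k f Fr G ->
  forall i, G i = g (Fr i).
Proof.
move=> fB; suff /choice[g gP] : forall S, exists T, forall Fr G, frame Fr ->
  frame G ->
    match_frames k f Fr G -> forall i, Fr i = S -> G i = T.
  by exists g => Fr G fF fG m i; apply: gP fF fG m _ erefl.
move=> S; have [pS|nS] := pselect (plane S); last first.
  by exists S => Fr G [pF _] _ _ i e; case: nS; rewrite -e.
have n0 : (0 < n)%N by lia.
pose i0 := Ordinal n0; have [F0 fF0 e0] := plane_frame i0 pS.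
have [||| G0 fG0 m0] := match_exists sympl dimV _ _ _ fB fF0; try lia.
exists (G0 i0) => Fr G fF fG m i e.
pose p := tperm i0 i; have pI : injective p by apply: perm_inj.
have := @match_agree f (Fr \o p) F0 (G \o p) G0 [set i0]%SET fB
  (frame_comp pI fF) fF0 (frame_comp pI fG) fG0 (match_comp pI m) m0.
rewrite /p => /(_ _ i0); rewrite /= tpermL; apply; rewrite ?inE //.
by move=> _ /finset.set1P ->; rewrite /= tpermL e.
Qed.

Variables (f f' : {vspace vT} -> {vspace vT}).
Hypotheses (fB : base_map om n k f) (f'B : base_map om n k f').
Hypothesis fK : forall U, Hgrass om k U -> f' (f U) = U.

Lemma fsum_neqC G I : frame G -> fsum G I <> fsum G (~: I).
Proof.
move=> fG /(fsum_inj sympl dimV fG)/finset.setP e.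
have n0 : (0 < n)%N by lia.
by have := e (Ordinal n0); rewrite inE; case: (_ \in _).
Qed.

Lemma card_setC_half I : #|I| = k -> #|~: I| = k.
Proof. by move=> cI; rewrite finset.cardsCs finset.setCK card_ord cI; lia. Qed.

(** The images of I and of its complement are distinct by injectivity and have the same two
    candidates, so they exhaust them. This is what makes f commute with [perp]. *)
Lemma match_setC Fr G I : frame Fr -> frame G -> match_frames k f Fr G ->
  #|I| = k ->
  forall J, f (fsum Fr I) = fsum G J -> (J = I \/ J = ~: I) /\ f (fsum Fr (~:
    I)) = fsum G (~: J).
Proof.
move=> fF fG m cI J e; have cI' := card_setC_half cI.
have [_ fI _] := fB.
have HF K : #|K| = k -> Hgrass om k (fsum Fr K) by move=> <-;
  apply: frame_Hgrass.
have ne : f (fsum Fr I) <> f (fsum Fr (~: I)).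
  by move/(fI _ _ (HF _ cI) (HF _ cI')); apply: fsum_neqC.
have eJ : J = I \/ J = ~: I.
  by case: (m I cI); rewrite e => /(fsum_inj sympl dimV fG) ->; [left|right].
split=> //; have := m _ cI'; rewrite finset.setCK => -[] e'; move: ne;
  rewrite e e';
  by case: eJ => -> //; rewrite finset.setCK.
Qed.

Lemma match_inv Fr G : frame Fr -> frame G -> match_frames k f Fr G ->
  match_frames k f' G Fr.
Proof.
move=> fF fG m I cI.
have HF K : #|K| = k -> Hgrass om k (fsum Fr K) by move=> <-;
  apply: frame_Hgrass.
have cI' := card_setC_half cI.
case: (m I cI) => e; first by left; rewrite -e fK //; apply: HF.
have [_] := match_setC fF fG m cI e; rewrite finset.setCK => e'.
by right; rewrite -e' fK //; apply: HF.
Qed.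

Lemma f_perp U : Hgrass om k U -> f (perp U) = perp (f U).
Proof.
move=> HU; have [Fr [I [fF cI ->]]] := Hgrass_frame sympl dimV HU.
have [||| G fG m] := match_exists sympl dimV _ _ _ fB fF; try lia.
have [J e] : exists J, f (fsum Fr I) = fsum G J.
  by case: (m I cI) => ->; [exists I | exists (~: I)].
have [_ e'] := match_setC fF fG m cI e.
by rewrite (perp_fsum sympl dimV) // e e' (perp_fsum sympl dimV).
Qed.

End PlaneMap.

Section PlaneMapInverse.
Variables (F : fieldType) (vT : vectType F) (om : {skew_symmetric vT}).
Hypothesis sympl : is_psymplectic om.
Variables n k : nat.
Hypothesis dimV : \dim {:vT} = (2 * n)%N.
Hypothesis n2k : n = (2 * k)%N.
Hypothesis n14 : (14 <= n)%N.
Implicit Types (S T U W : {vspace vT}).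

Local Notation perp := (orthov om).
Local Notation plane := (Hgrass om 1).
Local Notation frame := (frame om).

Variables (f f' : {vspace vT} -> {vspace vT}).
Hypotheses (fB : base_map om n k f) (f'B : base_map om n k f').
Hypothesis fK : forall U, Hgrass om k U -> f' (f U) = U.
Hypothesis fK' : forall U, Hgrass om k U -> f (f' U) = U.

(** Orthogonal planes S and T are made the first two planes of one frame; their images are then two
    different planes of the matched frame. The facts [ex] and [pp] are stated for any map with a
    left inverse on [Hgrass om k], to serve both f and f'. Read backwards, matched frames for f are
    matched for f', so g and g' are inverse. *)
Lemma plane_map : exists g g' : {vspace vT} -> {vspace vT},
  [/\ forall S, plane S -> [/\ plane (g S), plane (g' S),
    g' (g S) = S & g (g' S) = S],
      forall S T, plane S -> plane T -> perpv om S T -> perpv om (g S) (g T),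
      forall S T, plane S -> plane T -> perpv om S T -> perpv om (g' S) (g' T)
    & forall U, Hgrass om k U ->
      exists (Fr : 'I_n -> {vspace vT}) (I : {set 'I_n}),
        [/\ frame Fr, frame (g \o Fr), #|I| = k, U = fsum Fr I
          & f U = fsum (g \o Fr) I \/ f U = fsum (g \o Fr) (~: I)]].
Proof.
have n0 : (0 < n)%N by lia.
pose i0 := Ordinal n0.
have [g gP] := plane_map_exists sympl dimV n2k n14 fB.
have [g' gP'] := plane_map_exists sympl dimV n2k n14 f'B.
have ex (h h' : {vspace vT} -> {vspace vT}) (hB : base_map om n k h)
    (hK : forall U, Hgrass om k U -> h' (h U) = U) (Fr : 'I_n -> {vspace vT}) :
    frame Fr -> exists G : 'I_n -> {vspace vT}, [/\ frame G,
      match_frames k h Fr G & match_frames k h' G Fr].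
  move=> fF; have [||| G fG m] := match_exists sympl dimV _ _ _ hB fF; try lia.
  by exists G; split=> //; apply: (match_inv sympl dimV n2k n14 hB hK fF fG m).
have pp (h h' u : {vspace vT} -> {vspace vT}) (hB : base_map om n k h)
    (hK : forall U, Hgrass om k U -> h' (h U) = U)
    (uP : forall Fr G : 'I_n -> {vspace vT}, frame Fr -> frame G ->
      match_frames k h Fr G ->
      forall i, G i = u (Fr i)) S T :
    plane S -> plane T -> perpv om S T -> perpv om (u S) (u T).
  move=> pS pT ST; have [F0 fF0 e0] := plane_frame sympl dimV i0 pS.
  have n1 : (1 < n)%N by lia.
  pose i1 := Ordinal n1.
  have [|||Fr [fF eF Fi]] := @frame_replace _ _ _ sympl _ dimV F0 [set i0]%SET
    i1 T fF0.
  - by rewrite inE.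
  - exact: pT.
  - by rewrite fsum1 e0 orthov_sym.
  have [G [fG m _]] := ex _ _ hB hK _ fF.
  have eS : S = Fr i0 by rewrite eF ?inE.
  rewrite eS -Fi -!(uP _ _ fF fG m); case: fG => _; exact.
exists g, g'; split; [|exact: (pp f f' g)|exact: (pp f' f g')|].
  move=> S pS; have [F0 fF0 <-] := plane_frame sympl dimV i0 pS.
  have [G [fG m m']] := ex _ _ fB fK _ fF0.
  have [H [fH mH mH']] := ex _ _ f'B fK' _ fF0.
  rewrite -(gP _ _ fF0 fG m) -(gP' _ _ fF0 fH mH) -(gP' _ _ fG fF0 m') -(gP _ _
    fH fF0 mH').
  by split=> //; [case: fG | case: fH].
move=> U HU; have [Fr [I [fF cI ->]]] := Hgrass_frame sympl dimV HU.
have [G [fG m _]] := ex _ _ fB fK _ fF.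
have e : g \o Fr = G by apply/funext => i; rewrite /= (gP _ _ fF fG m).
by exists Fr, I; rewrite e; split=> //; apply: m.
Qed.

End PlaneMapInverse.

(** * From planes to points *)

Section Points.
Variables (F : fieldType) (vT : vectType F) (om : {skew_symmetric vT}).
Hypothesis sympl : is_psymplectic om.
Hypothesis dimV : (10 <= \dim {:vT})%N.
Implicit Types (S T U W Z : {vspace vT}) (x y z : vT) (g : {vspace vT} ->
  {vspace vT}).

Local Notation perp := (orthov om).
Local Notation plane := (Hgrass om 1).

Lemma exists_notin U : (\dim U < \dim {:vT})%N -> exists x, x \notin U.
Proof.
move=> lt; have /subvPn[x _ xU] : ~~ (fullv <= U)%VS; last by exists x.
by apply: contraTN lt => /dimvS; rewrite leqNgt.
Qed.

Lemma dim_plane S : plane S -> \dim S = 2%N. Proof. by case. Qed.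

Lemma plane_subE S T : plane S -> plane T -> (S <= T)%VS -> S = T.
Proof. by move=> [dS _] [dT _] ST; apply/eqP; rewrite eqEdim ST dS dT. Qed.

Lemma dim_plane_add S T : plane S -> plane T -> (\dim (S + T) <= 4)%N.
Proof. by move=> [dS _] [dT _]; have := dimv_sum_cap S T; rewrite dS dT;
  lia. Qed.

Lemma plane_cap_line S T x y : plane S -> plane T -> S <> T -> x != 0 ->
  x \in S -> x \in T -> y \in S -> y \in T -> y \in <[x]>%VS.
Proof.
move=> pS pT ST x0 xS xT yS yT; have [//|xy] := eqVneq (om x y) 0.
  exact: (plane_mem_line sympl pS).
case: ST; rewrite (plane_eq sympl pS xS yS xy).
exact/esym/(plane_eq sympl pT).
Qed.

(** The second generator must avoid U and not be orthogonal to x; one of w, u, u + w does both. *)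
Lemma plane_through x U : x != 0 -> (\dim U < \dim {:vT})%N ->
  exists T, [/\ plane T, x \in T & ~~ (T <= U)%VS].
Proof.
move=> x0 /exists_notin[w wU]; have [u xu] := om_exists sympl x0.
have E v : om x v != 0 -> v \notin U -> exists T, [/\ plane T,
  x \in T & ~~ (T <= U)%VS].
  move=> xv vU; exists (<[x]> + <[v]>)%VS; split.
  - exact: plane_line2.
  - exact: memv_line2l.
  - by rewrite line2_sub (negPf vU) andbF.
have [xw|xw] := eqVneq (om x w) 0; last exact: E wU.
have [uU|uU] := boolP (u \in U); last exact: E uU.
by apply: (E (u + w)); rewrite ?omDr ?xw ?addr0 // rpredDl.
Qed.

(* The orthogonal complement of S + T is spanned by its planes. *)
Lemma plane_closureP S T U : plane S -> plane T -> plane U ->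
  (U <= S + T)%VS <->
  (forall W, plane W -> perpv om W S -> perpv om W T -> perpv om W U).
Proof.
move=> pS pT pU; split=> [UST W pW WS WT|h].
  by apply: subv_trans (perpS om UST); rewrite perpD subv_cap; apply/andP.
rewrite -(perpK sympl (S + T)); set Z := perp (S + T).
have hW W : plane W -> (W <= Z)%VS -> perpv om W U.
  by move=> pW; rewrite /Z perpD subv_cap => /andP[]; apply: h.
(* [Z] has dimension at least 10 - 4, more than that of S + T, so it is not totally isotropic. A
   vector z of [Z] orthogonal to w2 is then handled as the difference of z + w1 and w1. *)
have /subvPn[w1 w1Z /mem_orthovPn[w2 w2Z w12]] : ~~ (Z <= perp Z)%VS.
  apply/negP => /dimvS; rewrite /Z (perpK sympl).
  have := dim_perp sympl (S + T); have := dim_plane_add pS pT; lia.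
have E a b : a \in Z -> b \in Z -> om a b != 0 -> forall u, u \in U ->
  om a u = 0.
  move=> aZ bZ ab u uU; apply: (perpvP _ _ _ (hW _ (plane_line2 sympl ab) _)) =>
    //.
    by rewrite line2_sub aZ.
  exact: memv_line2l.
apply/subvP => u uU; apply/mem_perp => z zZ; apply/eqP; rewrite om_eq0C;
  apply/eqP.
have [z2|z2] := eqVneq (om z w2) 0; last exact: E z2 _ uU.
have := E (z + w1) w2 _ w2Z _ u uU; rewrite omDl omDl z2 add0r memvD //.
by rewrite (E w1 w2 w1Z w2Z w12 u uU) addr0 => /(_ isT w12).
Qed.

(* If S and T met in a line, then S + S' = S + T for every plane S' <> S of
   S + T; so this witness tells the two cases apart in terms of sums only. *)
Lemma plane_disjoint_witness S T : plane S -> plane T -> (S :&: T = 0)%VS ->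
  exists S', [/\ plane S', (S' <= S + T)%VS, S' <> S & ~~ (T <= S + S')%VS].
Proof.
move=> pS pT ST0; have [dS ndS] := pS; have [dT _] := pT.
have dST : \dim (S + T) = 4%N by rewrite dimv_disjoint_sum // dS dT.
have [x [y [xy eS]]] := planeP sympl pS.
pose Z := (perp S :&: (S + T))%VS.
have eZ : (S + Z = S + T)%VS.
  by rewrite /Z vspace_modl ?addvSl // (nd_add_perp sympl ndS) capfv.
have /subvPn[z zZ z0] : ~~ (Z <= 0)%VS.
  by apply/negP; rewrite subv0 => /eqP Z0; move: dST; rewrite -eZ Z0 addv0 dS.
rewrite memv0 in z0; move: zZ => /memv_capP[/mem_perp zS zST].
have xS : x \in S by rewrite eS memv_line2l.
have yS : y \in S by rewrite eS memv_line2r.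
have pS' : plane (<[x + z]> + <[y]>)%VS.
  by apply: plane_line2; rewrite // omDl xy zS // addr0 oner_neq0.
exists (<[x + z]> + <[y]>)%VS; split=> //.
- have sub := subvP (addvSl S T).
  by rewrite line2_sub (memvD (sub _ xS) zST) (sub _ yS).
- move=> e; case/eqP: z0; apply: ndS => //.
  by rewrite -[z](addKr x) memvD ?memvN // -e memv_line2l.
(* S' lies in S + <z>, of dimension 3, too small to contain S + T. *)
- apply/negP => TS; have : (S + T <= S + <[z]>)%VS.
    rewrite subv_add addvSl /=; apply: subv_trans TS _.
    rewrite subv_add addvSl line2_sub (subvP (addvSl _ _) y) // andbT.
    by rewrite memv_add // memv_line.
  have := dimv_sum_cap S <[z]>; rewrite dim_vline z0 dS => dSz /dimvS.
  by rewrite dST; lia.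
Qed.

(** Half of an automorphism: together with [plane_hom g' g] it makes g a bijection of the planes
    preserving orthogonality both ways. *)
Definition plane_hom g g' :=
  (forall S, plane S -> plane (g S) /\ g' (g S) = S) /\
  (forall S T, plane S -> plane T -> perpv om S T -> perpv om (g S) (g T)).

Section PlaneAuto.
Variables g g' : {vspace vT} -> {vspace vT}.
Hypotheses (gP : plane_hom g g') (gP' : plane_hom g' g).

Lemma plane_hom_sub S T U : plane S -> plane T -> plane U ->
  (U <= S + T)%VS -> (g U <= g S + g T)%VS.
Proof.
move=> pS pT pU /(plane_closureP pS pT pU) h.
have [[[pgS eS] [pgT eT]] [pgU eU]] := (gP.1 S pS, gP.1 T pT, gP.1 U pU).
apply/plane_closureP => // W pW WS WT; have [pW' eW] := gP'.1 W pW.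
rewrite -eW; apply: gP.2 => //; apply: h => //; [rewrite -eS | rewrite -eT];
  exact: gP'.2.
Qed.

Lemma plane_hom_neq S T : plane S -> plane T -> S <> T -> g S <> g T.
Proof.
by move=> pS pT ST e; apply: ST; rewrite -(gP.1 S pS).2 e (gP.1 T pT).2.
Qed.

End PlaneAuto.

(** If the images were disjoint, the witness S' for them would pull back to a plane of S + T other
    than S. As S + T has dimension 3, that plane and S span it, so they span T; mapping forward
    contradicts the choice of S'. *)
Lemma plane_hom_meet g g' S T : plane_hom g g' -> plane_hom g' g ->
  plane S -> plane T -> S <> T -> (S :&: T != 0)%VS -> (g S :&: g T != 0)%VS.
Proof.
move=> gP gP' pS pT ST ST0; apply/eqP => e0.
have [[pgS eS] [pgT eT]] := (gP.1 S pS, gP.1 T pT).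
have [S' [pS' sS' nS' nT]] := plane_disjoint_witness pgS pgT e0.
have [pS'' eS'] := gP'.1 _ pS'.
have sub : (g' S' <= S + T)%VS.
  by rewrite -eS -eT; apply: (plane_hom_sub gP' gP).
have neq : g' S' <> S by rewrite -eS; apply: (plane_hom_neq gP').
case/negP: nT; rewrite -eS'; apply: (plane_hom_sub gP gP') => //.
have /eqP -> : (S + g' S' == S + T)%VS; last exact: addvSr.
rewrite eqEdim subv_add addvSl sub /=.
have := dimv_sum_cap S T; rewrite (dim_plane pS) (dim_plane pT).
move: ST0; rewrite -dimv_eq0 -lt0n => ST0 dST.
suff: (2 < \dim (S + g' S'))%N by lia.
rewrite ltnNge -(dim_plane pS); apply/negP => le; apply: neq.
apply: plane_subE => //; have /eqP -> : S == (S + g' S')%VS; last exact: addvSr.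
by rewrite eqEdim addvSl.
Qed.

(** The images of planes through x meet pairwise. If U is not in S + T, the lines where g U meets g
    S and g T coincide, since otherwise g U would lie in g S + g T and U in S + T; so g U contains
    the common line of g S and g T. A plane U inside S + T, other than S, is handled with S and a
    plane W through x outside S + T. *)
Lemma point_map_exists g g' x : plane_hom g g' -> plane_hom g' g -> x != 0 ->
  exists2 y, y != 0 & forall S, plane S -> x \in S -> y \in g S.
Proof.
move=> gP gP' x0.
have pg S : plane S -> plane (g S) by move=> /gP.1[].
have cap0 S T : x \in S -> x \in T -> (S :&: T != 0)%VS.
  move=> xS xT; apply: contraNneq x0 => e; rewrite -memv0 -e memv_cap xS xT //.
have meet S T : plane S -> plane T -> S <> T -> x \in S -> x \in T ->
    exists a, [/\ a != 0, a \in g S & a \in g T].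
  move=> pS pT ST xS xT; have := plane_hom_meet gP gP' pS pT ST (cap0 _ _ xS
    xT).
  rewrite -subv0 => /subvPn[a /memv_capP[aS aT]]; rewrite memv0 => a0.
  by exists a.
have step S T U y : plane S -> plane T -> plane U -> S <> T ->
    x \in S -> x \in T -> x \in U -> ~~ (U <= S + T)%VS ->
    y != 0 -> y \in g S -> y \in g T -> y \in g U.
  move=> pS pT pU ST xS xT xU nU y0 yS yT.
  have US : U <> S by move=> e; rewrite e addvSl in nU.
  have UT : U <> T by move=> e; rewrite e addvSr in nU.
  have [a [a0 aU aS]] := meet _ _ pU pS US xU xS.
  have [b [b0 bU bT]] := meet _ _ pU pT UT xU xT.
  have ba : b \in <[a]>%VS.
    have [ab|ab] := eqVneq (om a b) 0.
      exact: (plane_mem_line sympl (pg _ pU)).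
    case/negP: nU; rewrite -(gP.1 U pU).2 -(gP.1 S pS).2 -(gP.1 T pT).2.
    apply: (plane_hom_sub gP' gP); try exact: pg.
    rewrite (plane_eq sympl (pg _ pU) aU bU ab) line2_sub.
    by rewrite (subvP (addvSl _ _) a) // (subvP (addvSr _ _) b).
  have aT : a \in g T.
    move: ba b0 bT => /vlineP[c ->]; rewrite scaler_eq0 negb_or => /andP[c0 _].
    by move=> /(memvZ c^-1); rewrite scalerA mulVf // scale1r.
  have := plane_cap_line (pg _ pS) (pg _ pT) (plane_hom_neq gP pS pT ST) a0 aS
    aT yS yT.
  by move=> /vlineP[c ->]; apply: memvZ.
have ST4 S T : plane S -> plane T -> (\dim (S + T) < \dim {:vT})%N.
  by move=> pS pT; apply: leq_trans dimV; have := dim_plane_add pS pT; lia.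
have [S [pS xS _]] : exists S, [/\ plane S, x \in S & ~~ (S <= 0)%VS].
  by apply: plane_through => //; rewrite dimv0; lia.
have [T [pT xT nTS]] : exists T, [/\ plane T, x \in T & ~~ (T <= S)%VS].
  by apply: plane_through => //; rewrite (dim_plane pS); lia.
have ST : S <> T by move=> e; rewrite e subvv in nTS.
have [y [y0 yS yT]] := meet _ _ pS pT ST xS xT; exists y => // U pU xU.
have [UST|nU] := boolP (U <= S + T)%VS; last exact: (step S T).
have [->//|/eqP US] := eqVneq U S.
have [W [pW xW nW]] := plane_through x0 (ST4 _ _ pS pT).
have yW : y \in g W by apply: (step S T).
have SW : S <> W by move=> e; rewrite -e addvSl in nW.
(* If U were in S + W, then S + U, of dimension at least 3, would be all of S + W, and W would lie
   in S + T. *)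
apply: (step S W) => //; apply: contra nW => USW.
apply: subv_trans (addvSr S W) _; apply: (@subv_trans _ _ (S + U)%VS);
  last first.
  by rewrite subv_add addvSl.
have sub : (S + U <= S + W)%VS by rewrite subv_add addvSl.
rewrite -(geq_leqif (dimv_leqif_sup sub)).
have := dimv_sum_cap S W; have := dimv_sum_cap S U.
rewrite (dim_plane pS) (dim_plane pW) (dim_plane pU).
have : (0 < \dim (S :&: W))%N by rewrite lt0n dimv_eq0; apply: cap0.
suff : (\dim (S :&: U) < 2)%N.
  by clear; move: (\dim _) (\dim _) (\dim _) (\dim _) => a b c d; lia.
rewrite ltnNge -{1}(dim_plane pS); apply/negP => le; apply: US.
have /eqP e : (S :&: U)%VS == S by rewrite eqEdim capvSl.
by apply/esym/plane_subE => //; rewrite -e capvSr.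
Qed.

Lemma planes_through_line x z : x != 0 ->
  (forall S, plane S -> x \in S -> z \in S) -> z \in <[x]>%VS.
Proof.
move=> x0 h; have [S [pS xS _]] : exists S, [/\ plane S,
  x \in S & ~~ (S <= 0)%VS].
  by apply: plane_through => //; rewrite dimv0; lia.
have [T [pT xT nTS]] : exists T, [/\ plane T, x \in T & ~~ (T <= S)%VS].
  by apply: plane_through => //; rewrite (dim_plane pS); lia.
have ST : S <> T by move=> e; rewrite e subvv in nTS.
by apply: (plane_cap_line pS pT ST); rewrite ?h.
Qed.

(** A map of projective points, with h x an arbitrary representative of the image of the point of x;
    hence h itself need be neither linear nor injective. The last clause says that every point is
    reached. *)
Definition point_map (h : vT -> vT) :=
  [/\ forall x, (h x == 0) = (x == 0),
      forall x y, (om (h x) (h y) == 0) = (om x y == 0)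
    & forall z, z != 0 -> exists2 x, x != 0 & h x \in <[z]>%VS].

(** Non-orthogonal x and y span a plane, whose image contains h x and h y. Orthogonal vectors of a
    plane are proportional, and proportionality of h x and h y would pass back to x and y. A map h'
    made from g' inverts h up to scalars and gives the converse. *)
Lemma plane_hom_point_map g g' : plane_hom g g' -> plane_hom g' g ->
  exists2 h, point_map h & forall S x, plane S -> x \in S -> h x \in g S.
Proof.
have ex u u' : plane_hom u u' -> plane_hom u' u -> exists h : vT -> vT,
    (forall x, (h x == 0) = (x == 0)) /\ forall S x, plane S -> x \in S ->
      h x \in u S.
  move=> uP uP'; have /choice[h hP] x : exists y, (y == 0) = (x == 0) /\
      forall S, plane S -> x \in S -> y \in u S.
    have [->|x0] := eqVneq x 0; first by exists 0; rewrite eqxx; split=> // *;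
      apply: mem0v.
    have [y y0 yP] := point_map_exists uP uP' x0; exists y; split=> //.
    exact: negbTE.
  by exists h; split=> [x|S x pS xS]; have [h0 hS] := hP x => //; apply: hS.
move=> gP gP'; have [h [h0 hP]] := ex _ _ gP gP'.
have [h' [h'0 hP']] := ex _ _ gP' gP.
have hK x : x != 0 -> h' (h x) \in <[x]>%VS.
  move=> x0; apply: planes_through_line => // S pS xS.
  by have [pgS <-] := gP.1 S pS; apply: hP' => //; apply: hP.
have hK' x : x != 0 -> h (h' x) \in <[x]>%VS.
  move=> x0; apply: planes_through_line => // S pS xS.
  by have [pgS <-] := gP'.1 S pS; apply: hP => //; apply: hP'.
have lineC (a b : vT) : a \in <[b]>%VS -> a != 0 -> b \in <[a]>%VS.
  move=> /vlineP[c ->]; rewrite scaler_eq0 negb_or => /andP[c0 _].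
  by apply/vlineP; exists c^-1; rewrite scalerA mulVf // scale1r.
have lineT (a b c : vT) : a \in <[b]>%VS -> b \in <[c]>%VS -> a \in <[c]>%VS.
  by move=> /vlineP[s ->]; apply: memvZ.
have back x y : x != 0 -> y != 0 -> h y \in <[h x]>%VS -> y \in <[x]>%VS.
  move=> x0 y0 /vlineP[c hy]; apply: (lineT _ (h' (h y))).
    by apply: lineC; rewrite ?hK // h'0 h0.
  apply: planes_through_line => // S pS xS; have [pgS <-] := gP.1 S pS.
  by apply: hP' => //; rewrite hy memvZ // hP.
exists h => //; split=> // [x y|z z0]; last first.
  by exists (h' z); rewrite ?h'0 // hK'.
have h00 : h 0 = 0 by apply/eqP; rewrite h0 eqxx.
have [->|x0] := eqVneq x 0; first by rewrite h00 !linear0l.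
have [->|y0] := eqVneq y 0; first by rewrite h00 !linear0r.
apply/idP/idP; apply: contraLR => nz.
  have pS := plane_line2 sympl nz.
  have [xS yS] := (memv_line2l x y, memv_line2r x y).
  apply/negP => /eqP e; move: nz.
  have /vlineP[c ->] : y \in <[x]>%VS.
    apply: back => //; apply: (plane_mem_line sympl (gP.1 _ pS).1) => //.
    - exact: hP.
    - exact: hP.
    - by rewrite h0.
  by rewrite omZr om_alt // mulr0 eqxx.
have pT := plane_line2 sympl nz.
have [pS eS] := gP'.1 _ pT.
have [xS yS] := (hP' _ _ pT (memv_line2l _ _),
  hP' _ _ pT (memv_line2r (h x) (h y))).
apply/negP => /eqP e; move: nz.
have /vlineP[c yE] : y \in <[x]>%VS.
  apply: (lineT _ (h' (h y))); first by apply: lineC; rewrite ?hK // h'0 h0.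
  apply: (lineT _ (h' (h x))); last exact: hK.
  apply: (plane_mem_line sympl pS) => //; first by rewrite h'0 h0.
  have /vlineP[a ->] := hK _ x0; have /vlineP[b ->] := hK _ y0.
  by rewrite omZl omZr e !mulr0.
have : h y \in <[h x]>%VS.
  have hx0 : h x != 0 by rewrite h0.
  apply: planes_through_line => // S pS' xS'.
  have [pS2 eS2] := gP'.1 _ pS'; rewrite -eS2; apply: hP => //.
  rewrite yE memvZ //; have /vlineP[a ->] : x \in <[h' (h x)]>%VS.
    by apply: lineC; rewrite ?hK // h'0 h0.
  by rewrite memvZ // hP'.
by move=> /vlineP[a ->]; rewrite omZr om_alt // mulr0 eqxx.
Qed.

End Points.

(** * The fundamental theorem of projective geometry *)

Section SemilinearMap.
Variables (F : fieldType) (vT : vectType F) (om : {skew_symmetric vT}).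
Hypothesis sympl : is_psymplectic om.
Hypothesis dimV : (10 <= \dim {:vT})%N.
Implicit Types (S T U W Z : {vspace vT}) (x y z : vT) (a b c d : F).

Local Notation perp := (orthov om).

Lemma line_scale x c : c != 0 -> (<[c *: x]> = <[x]>)%VS.
Proof.
move=> c0; apply/eqP; rewrite eqEsubv -!memvE memvZ ?memv_line //=.
by apply/vlineP; exists c^-1; rewrite scalerA mulVf // scale1r.
Qed.

Lemma line_eq x y : y \in <[x]>%VS -> y != 0 -> (<[y]> = <[x]>)%VS.
Proof.
move=> /vlineP[c ->]; rewrite scaler_eq0 negb_or => /andP[c0 _].
exact: line_scale.
Qed.

Lemma exists_indep x y : exists z, z \notin (<[x]> + <[y]>)%VS.
Proof.
apply: exists_notin; apply: leq_ltn_trans (dimv_add_leqif _ _) _.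
by rewrite !dim_vline; case: (x != 0); case: (y != 0); lia.
Qed.

Lemma indep2 x y a b : x != 0 -> y \notin <[x]>%VS -> a *: x + b *: y = 0 ->
  a = 0 /\ b = 0.
Proof.
move=> x0 yx e; have b0 : b = 0.
  apply/eqP; apply: contraNT yx => b0; apply/vlineP; exists (- (b^-1 * a)).
  apply: (scalerI b0); rewrite scalerA mulrN mulrA divff // mul1r scaleNr.
  by apply/eqP; rewrite -addr_eq0 addrC e.
by move/eqP: e; rewrite b0 scale0r addr0 scaler_eq0 (negPf x0) orbF => /eqP.
Qed.

Lemma indep3 x y z a b c : x != 0 -> y \notin <[x]>%VS ->
  z \notin (<[x]> + <[y]>)%VS -> a *: x + b *: y + c *: z = 0 ->
  [/\ a = 0, b = 0 & c = 0].
Proof.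
move=> x0 yx zxy e; have c0 : c = 0.
  apply/eqP; apply: contraNT zxy => c0; apply/mem_lineD.
  exists (- (c^-1 * a)), (- (c^-1 * b)); apply: (scalerI c0).
  rewrite scalerDr !scalerA !mulrN !mulrA divff // !mul1r !scaleNr -opprD.
  by apply/eqP; rewrite -addr_eq0 addrC e.
move: e; rewrite c0 scale0r addr0 => /(indep2 x0 yx)[-> ->].
by [].
Qed.

Section PointMap.
Variable h : vT -> vT.
Hypothesis hP : point_map om h.

Let h_eq0 x : (h x == 0) = (x == 0). Proof. by have [] := hP. Qed.

Lemma mem_line2_perp x y z : reflect
  (forall w, om x w = 0 -> om y w = 0 -> om z w = 0) (z \in <[x]> + <[y]>)%VS.
Proof.
apply: (iffP idP) => [/mem_lineD[a [b ->]] w xw yw|hz].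
  by rewrite omDl !omZl xw yw !mulr0 addr0.
rewrite -(perpK sympl (<[x]> + <[y]>)); apply/mem_perp => w /mem_perp hw.
apply: hz; apply/eqP; rewrite om_eq0C; apply/eqP; apply: hw.
  exact: memv_line2l.
exact: memv_line2r.
Qed.

(** Membership in the line is tested on vectors orthogonal to x and y. As h reaches every point,
    testing against the vectors h v is enough, and h transports these tests in both directions. *)
Lemma point_map_line2 x y z :
  (h z \in <[h x]> + <[h y]>)%VS = (z \in <[x]> + <[y]>)%VS.
Proof.
have [h0 ho hs] := hP.
have E u v : om (h u) (h v) = 0 <-> om u v = 0.
  by split=> /eqP; [rewrite ho | rewrite -ho] => /eqP.
apply/idP/idP => /mem_line2_perp H; apply/mem_line2_perp => w.
  by move=> xw yw; apply/E/H; apply/E.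
have [->|w0] := eqVneq w 0; first by rewrite !linear0r.
have [v v0 /vlineP[c hv]] := hs _ w0.
have c0 : c != 0.
  by apply: contraNneq v0 => c0; rewrite -h0 hv c0 scale0r.
have e u : om (h u) w = 0 <-> om u v = 0.
  rewrite -(E u v) hv omZr; split=> [->|/eqP]; first by rewrite mulr0.
  by rewrite mulf_eq0 (negPf c0) /= => /eqP.
by move=> xw yw; apply/e/H; apply/e.
Qed.

Lemma point_map_line x z : (h z \in <[h x]>)%VS = (z \in <[x]>)%VS.
Proof. by rewrite -[<[h x]>%VS]addvv point_map_line2 addvv. Qed.

Variable e : vT.
Hypothesis e0 : e != 0.
Let E := h e.
Let E0 : E != 0. Proof. by rewrite h_eq0. Qed.

Let notin_neq0 x : x \notin <[e]>%VS -> x != 0.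
Proof. by apply: contraNneq => ->; rewrite mem0v. Qed.

(** The point of h (e + x) lies on the line joining those of E and h x and differs from both, so h x
    can be rescaled to some [lam x] for which E + [lam x] represents it. *)
Let lam_exists : exists lam : vT -> vT, forall x, x \notin <[e]>%VS ->
  [/\ lam x \in <[h x]>%VS, lam x != 0 & E + lam x \in <[h (e + x)]>%VS].
Proof.
suff H : forall x, exists l, x \notin <[e]>%VS ->
  [/\ l \in <[h x]>%VS, l != 0 & E + l \in <[h (e + x)]>%VS].
  by have [lam lamP] := choice H; exists lam.
move=> x; have [xe|xe] := boolP (x \in <[e]>%VS); first by exists 0.
have : h (e + x) \in (<[h e]> + <[h x]>)%VS.
  by rewrite point_map_line2 memv_add // memv_line.
move=> /mem_lineD[a [b hex]].
have a0 : a != 0.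
  apply: contraNneq xe => a0.
  have : h (e + x) \in <[h x]>%VS by rewrite hex a0 scale0r add0r memvZ
    ?memv_line.
  rewrite point_map_line => exx.
  have ex : e \in <[x]>%VS by rewrite -[e](addrK x) memvB ?memv_line.
  by rewrite (line_eq ex e0) memv_line.
have b0 : b != 0.
  apply: contraNneq xe => b0.
  have : h (e + x) \in <[h e]>%VS by rewrite hex b0 scale0r addr0 memvZ
    ?memv_line.
  by rewrite point_map_line => /memvB/(_ (memv_line e)); rewrite addrC addKr.
exists ((b / a) *: h x) => _; split; first by rewrite memvZ ?memv_line.
  by rewrite scaler_eq0 h_eq0 negb_or mulf_neq0 ?invr_eq0 // notin_neq0.
apply/vlineP; exists a^-1.
by rewrite hex scalerDr !scalerA mulVf // scale1r mulrC.
Qed.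

(** For e, x, y independent, h (e + x + y) lies in the span of E + [lam x] and [lam y] and in the
    one with x and y exchanged, so it is a multiple of E + [lam x] + [lam y]. It is also on the line
    joining E and h (x + y), so [lam x] + [lam y] has the property which characterizes
    [lam (x + y)]. *)
Lemma normalized_point_map : exists lam : vT -> vT,
  (forall x, x \notin <[e]>%VS -> lam x \in <[h x]>%VS /\ lam x != 0) /\
  (forall x y, x \notin <[e]>%VS -> y \notin <[e]>%VS ->
    x + y \notin <[e]>%VS ->
    lam (x + y) = lam x + lam y).
Proof.
have [lam lamP] := lam_exists; exists lam; split=> [x /lamP[]//|].
have EN x : x \notin <[e]>%VS -> lam x \notin <[E]>%VS.
  move=> xe; have [lx l0 _] := lamP x xe.
  apply: contra xe; rewrite -[x \in _]point_map_line => /line_eq/(_ l0) <-.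
  by rewrite (line_eq lx l0) memv_line.
have uniq x m : x \notin <[e]>%VS -> m \in <[h x]>%VS ->
    E + m \in <[h (e + x)]>%VS -> m = lam x.
  move=> xe mx mex; have [lx l0 lex] := lamP x xe.
  have /vlineP[c mE] : m \in <[lam x]>%VS by rewrite (line_eq lx l0).
  have l1 : E + lam x != 0.
    apply: contra (EN x xe) => /eqP/(canRL (addKr _)) ->.
    by rewrite addr0 memvN memv_line.
  have /vlineP[d] : E + m \in <[E + lam x]>%VS by rewrite (line_eq lex l1).
  rewrite mE scalerDr => /eqP; rewrite -subr_eq0 opprD addrACA -{1}[E]scale1r.
  rewrite -!scalerBl => /eqP /(indep2 E0 (EN x xe))[/eqP].
  rewrite subr_eq0 => /eqP <- /eqP; rewrite subr_eq0 => /eqP ->.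
  by rewrite scale1r.
have add_indep x y : x \notin <[e]>%VS -> y \notin (<[e]> + <[x]>)%VS ->
    lam (x + y) = lam x + lam y.
  move=> xe yex.
  have ye : y \notin <[e]>%VS by apply: contra yex; apply: (subvP (addvSl _ _)).
  have xye : x + y \notin <[e]>%VS.
    apply: contra yex => xye; rewrite -[y](addKr x) memvD //
      ?memvN ?memv_line2r //.
    exact: subvP (addvSl _ _) _ xye.
  have [[lx lx0 lex] [ly ly0 ley]] := (lamP x xe, lamP y ye).
  have YN : lam y \notin (<[E]> + <[lam x]>)%VS.
    apply: contra yex; rewrite -(point_map_line2 e x y) -(line_eq lx lx0).
    by rewrite !memvE (line_eq ly ly0).
  have memh u v w p q : p \in <[h u]>%VS -> p != 0 -> q \in <[h v]>%VS ->
    q != 0 ->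
      w \in (<[u]> + <[v]>)%VS -> h w \in (<[p]> + <[q]>)%VS.
    by move=> pu p0 qv q0; rewrite -point_map_line2 (line_eq pu p0) (line_eq qv
      q0).
  have nz u v : v \notin <[u]>%VS -> u + v != 0.
    by apply: contra => /eqP/(canRL (addKr _)) ->;
      rewrite addr0 memvN memv_line.
  have /mem_lineD[a [b h1]] : h (e + x + y) \in (<[E + lam x]> + <[lam y]>)%VS.
    by apply: (memh (e + x) y) => //; [apply/nz/EN | rewrite memv_add //
      memv_line].
  have /mem_lineD[c [d h2]] : h (e + x + y) \in (<[E + lam y]> + <[lam x]>)%VS.
    apply: (memh (e + y) x) => //; first by apply/nz/EN.
    by rewrite addrAC memv_add // memv_line.
  have /mem_lineD[p [q h3]] : h (x + y) \in (<[lam x]> + <[lam y]>)%VS.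
    by apply: (memh x y) => //; rewrite memv_add // memv_line.
  have /mem_lineD[r [t h4]] : h (e + x + y) \in (<[h e]> + <[h (x + y)]>)%VS.
    by rewrite point_map_line2 -addrA memv_add // memv_line.
  have ind u v w u' v' w' : u *: E + v *: lam x + w *: lam y =
      u' *: E + v' *: lam x + w' *: lam y -> [/\ u = u', v = v' & w = w'].
    move/eqP; rewrite -subr_eq0 !opprD addrACA [X in X + _]addrACA -!scalerBl.
    move=> /eqP/(indep3 E0 (EN x xe) YN)[/eqP u0 /eqP v0 /eqP w0].
    by split; apply/eqP; rewrite -subr_eq0.
  have [ac ad bc] : [/\ a = c, a = d & b = c].
    by apply: ind; rewrite -!scalerDr -h1 h2 scalerDr addrAC.
  have H : h (e + x + y) = a *: (E + (lam x + lam y)).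
    by rewrite h1 bc -ac -scalerDr addrA.
  have [_ atp atq] : [/\ a = r, a = t * p & a = t * q].
    apply: ind; rewrite -!scalerDr -addrA -H h4 h3 scalerDr !scalerA addrA //.
  have a0 : a != 0.
    have := h_eq0 (e + x + y); rewrite H scaler_eq0; case: eqP =>
      //= _ /esym/eqP.
    move=> /(canRL (addKr _)) yE; case/negP: yex; rewrite yE addr0 memvN.
    by rewrite memv_add // memv_line.
  apply/esym/uniq => //; last first.
    by rewrite [e + (x + y)]addrA; apply/vlineP; exists a^-1;
      rewrite H scalerA mulVf // scale1r.
  apply/vlineP; exists (a^-1 * t).
  by rewrite h3 scalerDr !scalerA -!mulrA -atp -atq mulVf // !scale1r.
move=> x y xe ye xye.
(* When y depends on e and x, a vector z independent of them is added, and [lam] of x + y + z is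
   computed in two ways. *)
have [yex|] := boolP (y \in (<[e]> + <[x]>)%VS); last exact: add_indep.
have [z zex] := exists_indep e x.
have sub v : v \in (<[e]> + <[x]>)%VS -> z \notin (<[e]> + <[v]>)%VS.
  move=> vex; apply: contra zex; apply: subvP.
  by rewrite line2_sub memv_line2l.
apply: (addIr (lam z)); rewrite -(add_indep (x + y) z) //; last first.
  by apply: sub; rewrite memvD // memv_line2r.
rewrite -addrA add_indep //; last by rewrite rpredDl.
by rewrite add_indep ?addrA //; apply: sub.
Qed.

Lemma exists_indep1 x : exists z, z \notin <[x]>%VS.
Proof.
by have [z zx] := exists_indep x x; exists z; rewrite addvv in zx.
Qed.

(** On the line of e, where [lam] is not controlled, l x is defined as [lam (x + u)] - [lam u]; [K]
    shows that this does not depend on the choice of u off the line. *)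
Lemma additive_point_map : exists l : vT -> vT,
  [/\ forall x, l x \in <[h x]>%VS, forall x, (l x == 0) = (x == 0)
    & forall x y, l (x + y) = l x + l y].
Proof.
have [lam [lamP lamD]] := normalized_point_map.
have [u ue] := exists_indep1 e.
have out x v : x \in <[e]>%VS -> v \notin <[e]>%VS -> x + v \notin <[e]>%VS.
  by move=> xe; rewrite rpredDl.
have K x v : x \in <[e]>%VS -> v \notin <[e]>%VS ->
  lam (x + v) - lam v = lam (x + u) - lam u.
  have K1 (a b : vT) : x \in <[e]>%VS -> a \notin <[e]>%VS ->
    b \notin <[e]>%VS ->
      a + b \notin <[e]>%VS -> lam (x + a) - lam a = lam (x + b) - lam b.
    move=> xe ae be abe; have e1 : lam (x + a) + lam b = lam (x + b) + lam a.
      have xab := out _ _ xe abe.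
      rewrite addrA in xab; have xba : x + b + a \notin <[e]>%VS by rewrite
        addrAC.
      by rewrite -(lamD _ _ (out _ _ xe ae) be xab) -(lamD _ _ (out _ _ xe be)
        ae xba) addrAC.
    by rewrite -[lam (x + a)](addrK (lam b)) e1 addrAC addrK.
  (* [K1] needs the sum of its two vectors to be off the line of e; if v + u is on it, a vector w
     independent of e and u serves as an intermediate. *)
  move=> xe ve; have [uve|] := boolP (v + u \in <[e]>%VS); last exact: K1.
  have [w we] := exists_indep e u.
  have w1 : w \notin <[e]>%VS by apply: contra we; apply: (subvP (addvSl _ _)).
  have w2 : w + u \notin <[e]>%VS.
    apply: contra we => wu; rewrite -[w](addrK u) memvB ?memv_line2r //.
    exact: (subvP (addvSl _ _)) wu.
  have w3 : v + w \notin <[e]>%VS.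
    apply: contra we => vw.
    have -> : w = (v + w) - (v + u) + u by rewrite opprD addrACA subrr add0r
      subrK.
    by apply: memvD (memv_line2r _ _); apply: (subvP (addvSl _ _));
      apply: memvB.
  by rewrite (K1 v w) // (K1 w u).
pose l x := if x \in <[e]>%VS then lam (x + u) - lam u else lam x.
have lin x v : x \in <[e]>%VS -> v \notin <[e]>%VS -> l x = lam (x + v) - lam v.
  by move=> xe ve; rewrite /l xe K.
have lout x : x \notin <[e]>%VS -> l x = lam x by move=> xe;
  rewrite /l (negPf xe).
exists l; split.
- move=> x; have [xe|xe] := boolP (x \in <[e]>%VS); last first.
    by rewrite lout //; case: (lamP x xe).
  (* For each v, l x lies in the span of h e and h v; taking two values of v independent modulo e
     leaves only the line of h e. *)
  have mem v : v \notin <[e]>%VS -> l x \in (<[h e]> + <[h v]>)%VS.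
    move=> ve; rewrite (lin x v) // memvB //; last first.
      by apply: (subvP (addvSr _ _)); case: (lamP v ve).
    have [l1 _] := lamP _ (out x v xe ve); move: l1; apply: subvP.
    rewrite -memvE point_map_line2; apply: memvD (memv_line2r _ _).
    exact: (subvP (addvSl _ _)) xe.
  have [->|x0] := eqVneq x 0.
    by rewrite (lin _ u) ?mem0v // add0r subrr mem0v.
  have xeE : (<[x]> = <[e]>)%VS by apply: line_eq.
  have hxE : (<[h x]> = <[h e]>)%VS.
    by apply: line_eq; rewrite ?h_eq0 // point_map_line.
  have [v ve] := exists_indep e u.
  have hue : h u \notin <[h e]>%VS by rewrite point_map_line.
  have hve : h v \notin (<[h e]> + <[h u]>)%VS by rewrite point_map_line2.
  have v1 : v \notin <[e]>%VS by apply: contra ve; apply: (subvP (addvSl _ _)).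
  have /mem_lineD[a [b lu]] := mem u ue; have /mem_lineD[c [d lv]] := mem v v1.
  have : (a - c) *: h e + b *: h u + (- d) *: h v = 0.
    by rewrite scalerBl scaleNr -addrA addrACA -opprD -lu -lv subrr.
  move=> /(indep3 E0 hue hve)[_ b0 _].
  by rewrite lu b0 scale0r addr0 hxE memvZ // memv_line.
- move=> x; have [xe|xe] := boolP (x \in <[e]>%VS); last first.
    by rewrite lout // (negPf (lamP x xe).2) (negPf (notin_neq0 xe)).
  rewrite (lin x u) //; have [->|x0] := eqVneq x 0;
    first by rewrite add0r subrr eqxx.
  apply/negP; rewrite subr_eq0 => /eqP lxu; apply: (negP ue).
  have [[l1 l10] [l2 l20]] := (lamP _ (out x u xe ue), lamP u ue).
  have xu : x \in <[u]>%VS.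
    rewrite -[x](addrK u) memvB ?memv_line // -point_map_line -(line_eq l2 l20)
      -lxu.
    by rewrite (line_eq l1 l10) memv_line.
  by rewrite -(line_eq xe x0) (line_eq xu x0) memv_line.
move=> x y; have [xe|xe] := boolP (x \in <[e]>%VS); have [ye|ye] :=
  boolP (y \in <[e]>%VS).
- rewrite (lin (x + y) u) ?memvD // (lin y u) // (lin x (y + u)) ?out //.
  by rewrite subrKA addrA.
- by rewrite (lout (x + y)) ?out // (lout y) // (lin x y) // subrK.
- by rewrite addrC (lout (y + x)) ?out // (lout x) // (lin y x) //
    [RHS]addrC subrK.
have [xye|xye] := boolP (x + y \in <[e]>%VS); last by rewrite !lout ?lamD.
have [v vex] := exists_indep e x.
have v1 : v \notin <[e]>%VS by apply: contra vex; apply: (subvP (addvSl _ _)).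
have yve : y + v \notin <[e]>%VS.
  apply: contra vex => yv; have -> : v = (y + v) - (x + y) + x.
    by rewrite [x + y]addrC opprD addrACA subrr add0r subrK.
  by apply: memvD (memv_line2r _ _); apply: (subvP (addvSl _ _)); apply: memvB.
rewrite (lin (x + y) v) // -addrA lamD // ?addrA ?out // (lout x) // (lout y) //
  lamD //.
by rewrite addrA addrK.
Qed.

End PointMap.
End SemilinearMap.

(** * Semilinearity and the multiplier of the form *)

Section SemilinearForm.
Variables (F : fieldType) (vT : vectType F) (om : {skew_symmetric vT}).
Hypothesis sympl : is_psymplectic om.
Hypothesis dimV : (10 <= \dim {:vT})%N.
Implicit Types (x y z : vT) (a b c d : F).

Lemma point_map_line_eq h l : point_map om h -> (forall x,
  l x \in <[h x]>%VS) ->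
  (forall x, (l x == 0) = (x == 0)) -> point_map om l.
Proof.
move=> [h0 ho hs] lh l0; split=> // [x y|z z0].
  have l00 : l 0 = 0 by apply/eqP; rewrite l0 eqxx.
  have [->|x0] := eqVneq x 0; first by rewrite l00 !linear0l.
  have [->|y0] := eqVneq y 0; first by rewrite l00 !linear0r.
  have /vlineP[c lx] := lh x; have /vlineP[d ly] := lh y.
  move: x0 y0; rewrite -(l0 x) -(l0 y) lx ly !scaler_eq0 !negb_or =>
    /andP[c0 _] /andP[d0 _].
  by rewrite omZl omZr !mulf_eq0 (negPf c0) (negPf d0) ho.
have [x x0 /vlineP[c hx]] := hs z z0; exists x => //.
by have /vlineP[d ->] := lh x; rewrite hx scalerA memvZ // memv_line.
Qed.

Section AdditivePointMap.
Variable l : vT -> vT.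
Hypothesis lP : point_map om l.
Hypothesis lD : forall x y, l (x + y) = l x + l y.

Let l_eq0 x : (l x == 0) = (x == 0). Proof. by have [] := lP. Qed.

(** Expanding l (a *: (x + y)) for independent x and y shows that a acts on l x and l y by the same
    scalar; dependent vectors are compared through a third one. *)
Lemma semilinear_exists : exists tau : F -> F, forall a x,
  l (a *: x) = tau a *: l x.
Proof.
have n0 : (\dim (0%VS : {vspace vT}) < \dim {:vT})%N by rewrite dimv0; lia.
have [x0 x00] := exists_notin n0; rewrite memv0 in x00.
have sc a x : exists t, l (a *: x) = t *: l x.
  by apply/vlineP; rewrite (point_map_line sympl lP) memvZ // memv_line.
have indep a x y t : x != 0 -> y \notin <[x]>%VS -> l (a *: x) = t *: l x ->
    l (a *: y) = t *: l y.
  move=> xn0 yx tx; have [s ty] := sc a y; have [r txy] := sc a (x + y).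
  move: txy; rewrite scalerDr !lD tx ty scalerDr => /eqP.
  rewrite -subr_eq0 opprD addrACA -!scalerBl => /eqP.
  have lx0 : l x != 0 by rewrite l_eq0.
  have lyx : l y \notin <[l x]>%VS by rewrite (point_map_line sympl lP).
  move=> /(indep2 lx0 lyx)[/eqP + /eqP].
  by rewrite !subr_eq0 => /eqP -> /eqP ->.
have /choice[tau tauP] a : exists t, l (a *: x0) = t *: l x0 := sc a x0.
exists tau => a x; have [xx|xx] := boolP (x \in <[x0]>%VS);
  last exact: indep (tauP a).
have [->|xn0] := eqVneq x 0.
  have l00 : l 0 = 0 by apply/eqP; rewrite l_eq0 eqxx.
  by rewrite scaler0 l00 scaler0.
have [z zx] := exists_indep1 dimV x0.
have zn0 : z != 0 by apply: contraNneq zx => ->; rewrite mem0v.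
apply: (indep a z x) => //; last exact: indep (tauP a).
apply: contra zx => xz; rewrite -(line_eq xx xn0) (line_eq xz xn0) memv_line //.
Qed.

Variable tau : F -> F.
Hypothesis tauP : forall a x, l (a *: x) = tau a *: l x.

Lemma semilinear_rmorphism : exists t : {rmorphism F -> F}, t =1 tau.
Proof.
have n0 : (\dim (0%VS : {vspace vT}) < \dim {:vT})%N by rewrite dimv0; lia.
have [x x0] := exists_notin n0; rewrite memv0 -l_eq0 in x0.
have inj a b : a *: l x = b *: l x -> a = b.
  by move/eqP; rewrite -subr_eq0 -scalerBl scaler_eq0 (negPf x0) orbF subr_eq0
    => /eqP.
have tD a b : tau (a + b) = tau a + tau b.
  by apply: inj; rewrite -tauP scalerDl lD !tauP scalerDl.
have tB : zmod_morphism tau.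
  move=> a b; apply/eqP; rewrite eq_sym subr_eq -tD subrK //.
have tM : monoid_morphism tau.
  split=> [|a b]; apply: inj; first by rewrite -tauP !scale1r.
  by rewrite -tauP -scalerA !tauP scalerA.
pose tA := GRing.isZmodMorphism.Build F F tau tB.
pose tR := GRing.isMonoidMorphism.Build F F tau tM.
by exists (HB.pack tau tA tR : {rmorphism F -> F}).
Qed.

End AdditivePointMap.

(** The ratio of [om (l u) (l v)] to [tau (om u v)] depends on u alone by [cross], hence on v alone
    by skew-symmetry; it is carried from x to any u through a vector orthogonal to neither. *)
Lemma semilinear_GammaSp (l : vT -> vT) (tau : {rmorphism F ->
  F}) : point_map om l ->
  (forall x y, l (x + y) = l x + l y) -> (forall a x,
    l (a *: x) = tau a *: l x) ->
  GammaSp om l.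
Proof.
move=> lP lD lZ; have [l0 lo ls] := lP.
have n0 : (\dim (0%VS : {vspace vT}) < \dim {:vT})%N by rewrite dimv0; lia.
have [x xn0] := exists_notin n0; rewrite memv0 in xn0.
have lx0 : l x != 0 by rewrite l0.
(* The point of l x + b l y is the image of that of some p x + q y; then b is [tau (q / p)]. *)
have /choice[sig sigP] b : exists a, tau a = b.
  have [y yx] := exists_indep1 dimV x.
  have lyx : l y \notin <[l x]>%VS by rewrite (point_map_line sympl lP).
  have nz : l x + b *: l y != 0.
    apply/eqP; rewrite -[l x]scale1r => /(indep2 lx0 lyx)[/eqP].
    by rewrite oner_eq0.
  have [w w0 /vlineP[c lw]] := ls _ nz.
  have c0 : c != 0 by move: w0; rewrite -l0 lw scaler_eq0 negb_or => /andP[].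
  have : w \in (<[x]> + <[y]>)%VS.
    rewrite -(point_map_line2 sympl lP) lw scalerDr scalerA.
    by apply/mem_lineD; exists c, (c * b).
  move=> /mem_lineD[p [q wE]]; move: lw; rewrite wE lD !lZ scalerDr scalerA =>
    /eqP.
  rewrite -subr_eq0 opprD addrACA -!scalerBl =>
    /eqP/(indep2 lx0 lyx)[/eqP + /eqP].
  rewrite !subr_eq0 => /eqP pc /eqP qc; exists (q / p).
  by rewrite fmorph_div pc qc mulrC mulrA mulVf // mul1r.
have tau_bij : bijective tau.
  by exists sig => // a; apply: (fmorph_inj tau); rewrite sigP.
have /choice[l' l'K] z : exists u, l u = z.
  have [->|z0] := eqVneq z 0.
    by exists 0; apply/eqP; rewrite l0 eqxx.
  have [w w0 /vlineP[c lw]] := ls _ z0.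
  have c0 : c != 0 by move: w0; rewrite -l0 lw scaler_eq0 negb_or => /andP[].
  by exists (sig c^-1 *: w); rewrite lZ sigP lw scalerA mulVf // scale1r.
have l_inj : injective l.
  have lN u : l (- u) = - l u by rewrite -scaleN1r lZ rmorphN1 scaleN1r.
  by move=> u v e; apply/eqP; rewrite -subr_eq0 -l0 lD lN e subrr eqxx.
exists tau; split=> //.
- by move=> a u v; rewrite lD lZ.
- by exists l' => // u; apply: l_inj; rewrite l'K.
(* The combination of v and w orthogonal to u has an image orthogonal to l u. *)
have cross u v w : tau (om u v) * om (l u) (l w) = tau (om u w) * om (l u) (l
  v).
  have : om u (om u v *: w + (- om u w) *: v) == 0.
    by rewrite omDr !omZr mulNr [om u v * _]mulrC subrr.
  rewrite -lo lD !lZ omDr !omZr rmorphN mulNr subr_eq0 => /eqP //.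
have [y xy] := om_exists sympl xn0.
have txy : tau (om x y) != 0 by rewrite fmorph_eq0.
pose c := om (l x) (l y) / tau (om x y).
have c0 : c != 0 by rewrite mulf_neq0 ?invr_eq0 // lo.
exists c => // u v.
have go p q r : om p q != 0 -> om (l p) (l q) = c * tau (om p q) ->
    om (l p) (l r) = c * tau (om p r).
  move=> pq e; have tpq : tau (om p q) != 0 by rewrite fmorph_eq0.
  by apply: (mulfI tpq); rewrite cross e mulrCA [RHS]mulrCA [T in c * T]mulrC.
have sw p q : om (l p) (l q) = c * tau (om p q) ->
  om (l q) (l p) = c * tau (om q p).
  by rewrite (omC om (l q)) (omC om q) rmorphN mulrN => ->.
have [->|u0] := eqVneq u 0.
  have -> : l 0 = 0 by apply/eqP; rewrite l0 eqxx.
  by rewrite !linear0l rmorph0 mulr0.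
have [z [xz uz]] := om_exists2 sympl xn0 u0.
apply: (go u z v uz); apply: (sw); apply: (go z x u);
  first by rewrite (om_eq0C om).
by apply: (sw); apply: (go x y z xy); rewrite /c divfK.
Qed.

Lemma point_map_GammaSp h : point_map om h ->
  exists2 l, GammaSp om l & forall x, l x \in <[h x]>%VS.
Proof.
move=> hP; have n0 : (\dim (0%VS : {vspace vT}) < \dim {:vT})%N by rewrite
  dimv0; lia.
have [x x0] := exists_notin n0; rewrite memv0 in x0.
have [l [lh l0 lD]] := additive_point_map sympl dimV hP x0.
have lP := point_map_line_eq hP lh l0.
have [tau tauP] := semilinear_exists lP lD.
have [t tE] := semilinear_rmorphism lP lD tauP.
exists l => //; apply: (@semilinear_GammaSp l t) => // a y.
by rewrite tE.
Qed.

End SemilinearForm.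

(** * Conclusion *)

Section Conclusion.
Variables (F : fieldType) (vT : vectType F) (om : {skew_symmetric vT}).
Hypothesis sympl : is_psymplectic om.
Variables n k : nat.
Hypothesis dimV : \dim {:vT} = (2 * n)%N.
Implicit Types (S T U W : {vspace vT}) (f : {vspace vT} -> {vspace vT}).

Local Notation perp := (orthov om).
Local Notation plane := (Hgrass om 1).
Local Notation H := (Hgrass om k).

Lemma preserves_base_map f : set_bij H H f -> preserves_base_subsets om k f ->
  exists f', [/\ base_map om n k f, base_map om n k f',
    forall U, H U -> f' (f U) = U & forall U, H U -> f (f' U) = U].
Proof.
move=> [fH fI fS] [fB fB'].
have /choice[f' f'P] U : exists W, H U -> H W /\ f W = U.
  have [HU|nU] := pselect (H U); last by exists U.
  by have [W HW <-] := fS _ HU; exists W.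
have inj U W : H U -> H W -> f U = f W -> U = W.
  by move=> HU HW; apply: fI; apply: mem_set.
have fK U : H U -> f' (f U) = U.
  by move=> HU; have [HW e] := f'P _ (fH _ HU); apply: inj.
exists f'; split=> //; last by move=> U /f'P[].
  split=> // Fr fF; have /fB/(base_fam sympl dimV)[G fG ->] :=
    fam_base sympl dimV k fF.
  by exists G.
split=> [U /f'P[]//|U W HU HW e|Fr fF].
  by have [_ <-] := f'P _ HU; have [_ <-] := f'P _ HW; rewrite e.
(* The hypothesis on the inverse speaks of preimages under f; within [H] these are the images under
   f'. *)
have /fB'/(base_fam sympl dimV)[G fG e] := fam_base sympl dimV k fF.
exists G => //; rewrite -e; apply/seteqP; split=> [_ [U FU <-]|U [HU FU]] /=.
  have HU := fam_Hgrass fF FU; have [HW eW] := f'P _ HU.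
  by split=> //=; rewrite eW.
by exists (f U) => //; apply: fK.
Qed.

(** Only inclusions l S in g S are known. For the reverse one, the preimage of y is split along J
    and its complement; the image of the second part lies in two orthogonal summands, so it
    vanishes. *)
Lemma semilinear_image (g : {vspace vT} -> {vspace vT}) (l : vT -> vT)
    (Fr : 'I_n -> {vspace vT}) (J : {set 'I_n}) : GammaSp om l ->
    (forall S x, plane S -> x \in S -> l x \in g S) ->
    frame om Fr -> frame om (g \o Fr) ->
  (l @` [set` fsum Fr J])%classic = [set` fsum (g \o Fr) J]%classic.
Proof.
move=> [tau [_ lL [l' lK l'K] _]] lg fF fG.
have lD : {morph l : x y / x + y}.
  by move=> x y; have := lL 1 x y; rewrite /= rmorph1 !scale1r.
have l0 : l 0 = 0 by apply: (addrI (l 0)); rewrite -lD !addr0.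
have sub K x : x \in fsum Fr K -> l x \in fsum (g \o Fr) K.
  move=> /memv_sumP[v vF ->]; rewrite (big_morph l lD l0); apply: memv_sumr =>
    i iK.
  by apply: lg; [case: fF | apply: vF].
apply/seteqP; split=> [_ [x /= xJ <-]|y /= yJ]; first exact: sub.
exists (l' y); rewrite ?l'K //=.
have [_ ndJ] := frame_Hgrass J fF; have [_ ndG] := frame_Hgrass J fG.
have : l' y \in (fsum Fr J + fsum Fr (~: J)%SET)%VS.
  by rewrite -(perp_fsum sympl dimV) // (nd_add_perp sympl ndJ) memvf.
move=> /memv_addP[a aJ [b bJ e]].
have lb : l b = y - l a by rewrite -[y]l'K e lD addrC addKr.
have : l b \in (fsum (g \o Fr) J :&: perp (fsum (g \o Fr) J))%VS.
  rewrite memv_cap (perp_fsum sympl dimV) // (sub _ b bJ) andbT lb memvB //.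
  exact: sub.
rewrite (nd_cap ndG) memv0 -l0 => /eqP/(can_inj lK) b0.
by rewrite e b0 addr0.
Qed.

Hypotheses (n2k : n = (2 * k)%N) (n14 : (14 <= n)%N).

Lemma Hgrass_half_perp U : H U -> H (perp U).
Proof.
move=> /(Hgrass_perp sympl dimV); suff -> : (n - k = k)%N by [].
by lia.
Qed.

(** In half the dimension of V, orthogonality leaves no room, which reduces the preservation of
    orthogonality to [f_perp]. *)
Lemma perpv_half U W : H U -> H W -> perpv om U W <-> U = perp W.
Proof.
move=> [dU _] /Hgrass_half_perp[dW _]; split=> [UW|->]; last exact: subvv.
by apply/eqP; rewrite eqEdim (UW : (U <= perp W)%VS) dU dW leqnn.
Qed.

End Conclusion.

Unset Implicit Arguments.
Local Open Scope classical_set_scope.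

Theorem theorem2 (F : fieldType) (vT : vectType F) (om : {skew_symmetric vT})
    (n k : nat) (f : {vspace vT} -> {vspace vT})
    (dimV : \dim {:vT} = (2 * n)%N) (sympl : is_psymplectic om)
    (n_eq : n = (2 * k)%N) (n_ge : (14 <= n)%N)
    (f_bij : set_bij (Hgrass om k) (Hgrass om k) f)
    (f_base : preserves_base_subsets om k f) :
  (forall U W : {vspace vT}, Hgrass om k U -> Hgrass om k W ->
     (perpv om U W <-> perpv om (f U) (f W))) /\
  (exists fbar : set {vspace vT} -> set {vspace vT},
    [/\ set_bij (Hgrass_bar om k) (Hgrass_bar om k) fbar,
        forall U : {vspace vT}, Hgrass om k U ->
          fbar [set U; orthov om U] = [set f U; f (orthov om U)]
      & exists2 l : vT -> vT, GammaSp om l &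
          forall U : {vspace vT}, Hgrass om k U ->
            [set [set` f U]; [set` f (orthov om U)]] =
            [set l @` [set` U]; l @` [set` orthov om U]] :> set (set vT)]).
Proof.
have [f' [fB f'B fK f'K]] := preserves_base_map sympl dimV f_bij f_base.
have [fH fI _] := fB; have [f'H _ _] := f'B.
have f_perpU := f_perp sympl dimV n_eq n_ge fB.
have Hp := Hgrass_half_perp sympl dimV n_eq n_ge.
have pair U : f @` [set U; orthov om U] = [set f U; f (orthov om U)].
  by rewrite image_setU !image_set1.
split.
  move=> U W HU HW; rewrite !(perpv_half sympl dimV n_eq n_ge) //;
    try exact: fH.
  rewrite -f_perpU //; split=> [->//|]; apply: fI => //; exact: Hp.
exists (fun A => f @` A); split.
- split.
  + move=> _ [U -> UH] /=; have HU : Hgrass om k U by apply: UH; left.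
    rewrite pair f_perpU //; exists (f U) => // W [->|->]; first exact: fH.
    by apply: Hp; apply: fH.
  + move=> A B /set_mem[UA _ AH] /set_mem[UB _ BH] e.
    have s C D : C `<=` Hgrass om k -> D `<=` Hgrass om k -> f @` C = f @` D ->
      C `<=` D.
      move=> CH DH CD U CU; have : (f @` D) (f U) by rewrite -CD; exists U.
      by move=> [W DW /fI <-] //; [apply: DH | apply: CH].
    by apply/seteqP; split; apply: s.
  + move=> _ [W -> WH]; have HW : Hgrass om k W by apply: WH; left.
    have HU := f'H _ HW.
    exists [set f' W; orthov om (f' W)]; last by rewrite pair f_perpU // f'K.
    by exists (f' W) => // U [->|->] //; apply: Hp.
- by move=> U _; apply: pair.
have [g [g' [gP gperp g'perp gf]]] := plane_map sympl dimV n_eq n_ge fB f'B fK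
  f'K.
have dim10 : (10 <= \dim {:vT})%N by rewrite dimV; lia.
have [|| h hP hg] := @plane_hom_point_map _ _ _ sympl dim10 g g'.
- by split=> // S /gP[].
- by split=> // S /gP[].
have [l lG lh] := point_map_GammaSp sympl dim10 hP.
exists l => // U HU; have [Fr [I [fF fG cI UE fUE]]] := gf _ HU.
have lg S x : Hgrass om 1 S -> x \in S -> l x \in g S.
  by move=> pS xS; have /vlineP[c ->] := lh x; apply/memvZ/hg.
have im J := semilinear_image sympl dimV J lG lg fF fG.
rewrite f_perpU // [in RHS]UE (perp_fsum sympl dimV) // !im.
(* The second alternative for f U gives the same two sets in the other order. *)
case: fUE => ->; rewrite (perp_fsum sympl dimV) //.
by rewrite finset.setCK setUC.
Qed.
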